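(* Let $G$ be a finite group with a surjective homomorphism $G\to\mathbb Z_2^N$, let $s:\mathbb Z_2^N\to\mathbb Z_2$ be a homomorphism (also viewed as a homomorphism on $G$ by composition), let $\omega$ be a normalized $U(1)$-valued 2-cocycle on $G$ (coefficients twisted by $s$), and regard $R=\mathbb C[G,\omega,s]$ as a $\mathbb Z_2^N$-graded real algebra. Let $G_c$ be the preimage of $c\in\mathbb Z_2^N$ and fix an element $g_c\in G_c$ for each $c\in\mathbb Z_2^N$. Let $V$ be a simple $\mathbb C[G_0,\omega]$-module with representation $\rho_0$. (1) $R\otimes_{\mathbb C[G_0,\omega]}V$ is a simple $\mathbb Z_2^N$-graded $R$-module. As a $\mathbb C[G_0,\omega]$-module it is isomorphic to $\bigoplus_{c}g_c\otimes_{\mathbb C[G_0,\omega]}V$, and thus to $\bigoplus_{c\in\mathbb Z_2^N}V^{g_c}$. Under the identification of the underlying space with $\bigoplus_{c\in\mathbb Z_2^N}V$, its representation $\rho$ has block entries $$\rho(z)_{cc'}=\delta_{c,c'}\,\rho_0({}^{g_c}z)\ (z\in\mathbb C),\qquad \rho(g)_{cc'}=\delta_{c,c'+d}\,\nu(g_c,g,g_{c'})\,\rho_0(g_c^{-1}gg_{c'})\ (g\in G_d,\ d\in\mathbb Z_2^N).$$ (2) Let $E=\{c\in\mathbb Z_2^N: V^{g_c}\cong V\}$, a subspace of $\mathbb Z_2^N$, and choose a basis $\{z_i\}$ of $E$ such that $s(z_1)=1$ and $s(z_i)=0$ for $i\ne1$ when $s$ is nontrivial. Let $D$ be the graded endomorphism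 algebra of the module in (1) (all $R$-linear endomorphisms, $\mathbb Z_2^N$-graded). It is a graded division algebra with $D_c\neq 0$ exactly for $c\in E$, and $D_0=\mathbb C$, acting on $\bigoplus_{c}V$ diagonally by $\rho_0(z)$. If $f_i:V\to V^{g_{z_i}}$ is an isomorphism of $\mathbb C[G_0,\omega]$-modules, then $$(\theta_i)_{cc'}=\delta_{c,c'+z_i}\,\nu(g_c,g_{c'},g_{z_i})\,\rho_0(g_c^{-1}g_{c'}g_{z_i})\,f_i$$ defines an invertible element $\theta_i$ of $D_{z_i}$, and $D_0$ together with the $\theta_i$ generates $D$. Each $\theta_i^2$ is the identity up to a scalar. For $i$ with $s(z_i)=0$, one can multiply $f_i$ by a scalar so that $\theta_i^2=1$; for $i=1$ with $s(z_1)=1$, $\theta_1$ is antilinear and one can multiply $f_1$ by a scalar so that $\theta_1^2=\pm1$. With these choices $a_{ij}=(\theta_i\theta_j)^2\in\{\pm1\}$ for $i\ne j$. (3) There is an isomorphism of $\mathbb Z_2^N$-graded algebras $\Phi=(\rho_i)$, $$\mathbb C[G,\omega,s]\cong\prod_iM_{d_i'}(D_i)(\bar c_i),$$ where $i$ runs over the simple $\mathbb Z_2^N$-graded $R$-modules up to isomorphism and grading shift (there is one component for each equivalence class of simple $\mathbb C[G_0,\omega]$-modules under the relation $V\sim W$ if $V\cong W^{g_c}$ for some $c\in\mathbb Z_2^N$), $D_i$ is the opposite algebra of the graded endomorphism algebra described in (2), and $d_i'=|\mathbb Z_2^N/E_i|\,d_{i_0}=d_i/\dim_{\mathbb R}D_i$,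 where $E_i$ is the subspace $E$ for $i$, $d_{i_0}$ is the complex dimension of the corresponding simple $\mathbb C[G_0,\omega]$-module and $d_i$ is the real dimension of the simple graded $R$-module. Here $\bar c_i$ lists a set of representatives of $\mathbb Z_2^N/E_i$, each repeated $d_{i_0}$ times.
   Context: $G$ acts on $\mathbb C$ by ${}^gz=z$ if $s(g)=0$ and ${}^gz=\bar z$ if $s(g)=1$; $\omega$ is a $U(1)$-valued 2-cocycle for this action with $\omega(1,g)=\omega(g,1)=1$. $\mathbb C[G,\omega,s]$ is the real associative algebra that is a left $\mathbb C$-vector space with basis $G$, with $g\cdot g'=\omega(g,g')\,gg'$ and $gz={}^gz\,g$. Its degree-$c$ part is spanned over $\mathbb C$ by $G_c$; its degree-0 part is the twisted group algebra $\mathbb C[G_0,\omega]$. $\nu(g_1,g_2,g_3)\in U(1)$ is defined by $(g_1)^{-1}\cdot g_2\cdot g_3=\nu(g_1,g_2,g_3)\,g_1^{-1}g_2g_3$, where $(g_1)^{-1}$ is the inverse in the algebra and $g_1^{-1}g_2g_3$ on the right is the group product; explicitly $\nu(g_1,g_2,g_3)={}^{g_1}\omega(g_1,g_1^{-1})^{-1}\,{}^{g_1}\omega(g_2,g_3)\,\omega(g_1^{-1},g_2g_3)$. $V$ is regarded as a complex vector space with complex structure $\rho_0(i)$; a scalar $\nu(\cdot,\cdot,\cdot)$ written in front of $\rho_0$ acts on $V$ through this structure, i.e. as $\rho_0(\nu)$. $V^{g_c}$ is the real vector space $V$ with the $\mathbb C[G_0,\omega]$-action $g\cdot v=\nu(g_c,g,g_c)\,\rho_0(g_c^{-1}gg_c)(v)$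 for $g\in G_0$ and $z\cdot v=\rho_0({}^{g_c}z)(v)$ for $z\in\mathbb C$. A graded division algebra is a graded algebra whose nonzero homogeneous elements are all invertible. For a $\mathbb Z_2^N$-graded algebra $D$ and $\bar c=(c_1,\dots,c_d)\in(\mathbb Z_2^N)^d$, $M_d(D)(\bar c)$ is the algebra of $d\times d$ matrices over $D$ graded so that the degree-$\lambda$ part consists of matrices whose $(k,j)$ entry lies in $D_{c_k+\lambda-c_j}$. The grading shift of a graded module $W$ is $W(c)_{c'}=W_{c'+c}$. *)

(* Defs.v *)
From HB Require Import structures.
From mathcomp Require Import all_boot all_order all_algebra all_fingroup.
From mathcomp Require Import boolp reals complex.

Set Implicit Arguments.
Unset Strict Implicit.
Unset Printing Implicit Defensive.

Import GRing.Theory Num.Theory.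
Local Open Scope ring_scope.

Notation Z2 N := 'rV['F_2]_N.

(* V with its scalars restricted along f : A -> B. *)
Definition restr (A B : pzRingType) (f : {rmorphism A -> B}) (V : lmodType B)
  : Type := V.

Section Restr.
Variables (A B : pzRingType) (f : {rmorphism A -> B}) (V : lmodType B).

HB.instance Definition _ := GRing.Zmodule.on (restr f V).

Definition restr_scale (a : A) (v : restr f V) : restr f V := f a *: (v : V).

Lemma restr_scaleA a b v : restr_scale a (restr_scale b v) = restr_scale (a * b) v.
Proof. by rewrite /restr_scale scalerA rmorphM. Qed.

Lemma restr_scale1 : left_id 1 restr_scale.
Proof. by move=> v; rewrite /restr_scale rmorph1 scale1r. Qed.

Lemma restr_scaleDr : right_distributive restr_scale +%R.
Proof. by move=> a u v; rewrite /restr_scale -scalerDr. Qed.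

Lemma restr_scaleDl v : {morph restr_scale^~ v : a b / a + b}.
Proof. by move=> a b; rewrite /restr_scale rmorphD scalerDl. Qed.

HB.instance Definition _ := GRing.Zmodule_isLmodule.Build A (restr f V)
  restr_scaleA restr_scale1 restr_scaleDr restr_scaleDl.

End Restr.

Definition dsum (A : pzRingType) (I : finType) (V : I -> lmodType A) : Type :=
  forall i, V i.

Section DirectSum.
Variables (A : pzRingType) (I : finType) (V : I -> lmodType A).
Implicit Types u v w : dsum V.

HB.instance Definition _ := gen_eqMixin (dsum V).
HB.instance Definition _ := gen_choiceMixin (dsum V).

Definition dsum_add u v : dsum V := fun i => u i + v i.
Definition dsum_opp u : dsum V := fun i => - u i.
Definition dsum_zero : dsum V := fun i => 0.
Definition dsum_scale (a : A) u : dsum V := fun i => a *: u i.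

Lemma dsum_addA : associative dsum_add.
Proof. by move=> u v w; apply: functional_extensionality_dep => i; apply: addrA. Qed.

Lemma dsum_addC : commutative dsum_add.
Proof. by move=> u v; apply: functional_extensionality_dep => i; apply: addrC. Qed.

Lemma dsum_add0 : left_id dsum_zero dsum_add.
Proof. by move=> u; apply: functional_extensionality_dep => i; apply: add0r. Qed.

Lemma dsum_addN : left_inverse dsum_zero dsum_opp dsum_add.
Proof. by move=> u; apply: functional_extensionality_dep => i; apply: addNr. Qed.

HB.instance Definition _ :=
  GRing.isZmodule.Build (dsum V) dsum_addA dsum_addC dsum_add0 dsum_addN.

Lemma dsum_scaleA a b v : dsum_scale a (dsum_scale b v) = dsum_scale (a * b) v.
Proof. by apply: functional_extensionality_dep => i; apply: scalerA. Qed.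

Lemma dsum_scale1 : left_id 1 dsum_scale.
Proof. by move=> v; apply: functional_extensionality_dep => i; apply: scale1r. Qed.

Lemma dsum_scaleDr : right_distributive dsum_scale +%R.
Proof.
by move=> a u v; apply: functional_extensionality_dep => i; apply: scalerDr.
Qed.

Lemma dsum_scaleDl v : {morph dsum_scale^~ v : a b / a + b}.
Proof.
by move=> a b; apply: functional_extensionality_dep => i; apply: scalerDl.
Qed.

HB.instance Definition _ := GRing.Zmodule_isLmodule.Build A (dsum V)
  dsum_scaleA dsum_scale1 dsum_scaleDr dsum_scaleDl.

End DirectSum.

(* The ring of A-linear endomorphisms of T under composition, with the K-vector
   space structure coming from K -> A.  It is the zero ring when T = 0, hence
   only a pzRingType and not an algType K. *)
Definition gend (K : comNzRingType) (A : algType K) (T : lmodType A) : Type :=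
  {linear T -> T}.

Section Endomorphisms.
Variables (K : comNzRingType) (A : algType K) (T : lmodType A).
Implicit Types f g h : gend T.

HB.instance Definition _ := gen_eqMixin (gend T).
HB.instance Definition _ := gen_choiceMixin (gend T).

Definition gend_val f : {linear T -> T} := f.
Coercion gend_val : gend >-> GRing.Linear.type.

Lemma gendP f g : (forall t, f t = g t) -> f = g.
Proof.
case: f g => [f [[hf1] [hf2]]] [g [[hg1] [hg2]]] /= e.
have {}e : f = g by apply: functional_extensionality_dep.
case: _ / e hg1 hg2 => hg1 hg2.
by rewrite (Prop_irrelevance hg1 hf1) (Prop_irrelevance hg2 hf2).
Qed.

Definition gend_zero : gend T := (\0 : {linear T -> T}).
Definition gend_add f g : gend T := (gend_val f \+ gend_val g : {linear T -> T}).
Definition gend_opp f : gend T := (\- gend_val f : {linear T -> T}).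
Definition gend_one : gend T := (idfun : {linear T -> T}).
Definition gend_mul f g : gend T := (gend_val f \o gend_val g : {linear T -> T}).

Fact gend_scale_linear (x : K) f : linear (fun t => x%:A *: f t).
Proof.
move=> a u v; rewrite linearP scalerDr !scalerA.
by rewrite mulr_algl -mulr_algr.
Qed.

Definition gend_scale (x : K) f : gend T :=
  HB.pack (fun t => x%:A *: f t)
    (GRing.isLinear.Build A T T _ _ (gend_scale_linear x f)).

Lemma gend_addA : associative gend_add.
Proof. by move=> f g h; apply: gendP => t; apply: addrA. Qed.

Lemma gend_addC : commutative gend_add.
Proof. by move=> f g; apply: gendP => t; apply: addrC. Qed.

Lemma gend_add0 : left_id gend_zero gend_add.
Proof. by move=> f; apply: gendP => t; apply: add0r. Qed.

Lemma gend_addN : left_inverse gend_zero gend_opp gend_add.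
Proof. by move=> f; apply: gendP => t; apply: addNr. Qed.

HB.instance Definition _ :=
  GRing.isZmodule.Build (gend T) gend_addA gend_addC gend_add0 gend_addN.

Lemma gend_mulA : associative gend_mul.
Proof. by move=> f g h; apply: gendP. Qed.

Lemma gend_mul1 : left_id gend_one gend_mul.
Proof. by move=> f; apply: gendP. Qed.

Lemma gend_1mul : right_id gend_one gend_mul.
Proof. by move=> f; apply: gendP. Qed.

Lemma gend_mulDl : left_distributive gend_mul gend_add.
Proof. by move=> f g h; apply: gendP. Qed.

Lemma gend_mulDr : right_distributive gend_mul gend_add.
Proof. by move=> f g h; apply: gendP => t; apply: raddfD. Qed.

HB.instance Definition _ := GRing.Zmodule_isPzRing.Build (gend T)
  gend_mulA gend_mul1 gend_1mul gend_mulDl gend_mulDr.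

Lemma gend_scaleA x y f : gend_scale x (gend_scale y f) = gend_scale (x * y) f.
Proof. by apply: gendP => t /=; rewrite scalerA -scalerAl mul1r scalerA. Qed.

Lemma gend_scale1 : left_id 1 gend_scale.
Proof. by move=> f; apply: gendP => t /=; rewrite !scale1r. Qed.

Lemma gend_scaleDr : right_distributive gend_scale +%R.
Proof. by move=> x f g; apply: gendP => t /=; apply: scalerDr. Qed.

Lemma gend_scaleDl f : {morph gend_scale^~ f : x y / x + y}.
Proof. by move=> x y; apply: gendP => t; rewrite /= scalerDl scalerDl. Qed.

HB.instance Definition _ := GRing.Zmodule_isLmodule.Build K (gend T)
  gend_scaleA gend_scale1 gend_scaleDr gend_scaleDl.

End Endomorphisms.

Definition has_dim (K : pzRingType) (V : lmodType K) (n : nat) : Prop :=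
  exists e : 'I_n -> V,
    forall v, exists! x : {ffun 'I_n -> K}, v = \sum_i x i *: e i.

Definition lmod_iso (A : pzRingType) (V W : lmodType A) : Prop :=
  exists f : {linear V -> W}, bijective f.

Definition simple_module (A : pzRingType) (V : lmodType A) : Prop :=
  (exists v : V, v != 0) /\
  forall S : {pred V}, submod_closed S -> S =i pred1 0 \/ S =i predT.

(* (T, tau) is the left A-module A (x)_B V, with tau a v = a (x) v, where A is
   a right B-module through i : B -> A. *)
Section Tensor.
Variables (A B : pzRingType) (i : {rmorphism B -> A}) (V : lmodType B).

Definition balanced (M : zmodType) (phi : A -> V -> M) : Prop :=
  [/\ forall a v w, phi a (v + w) = phi a v + phi a w,
      forall a b v, phi (a + b) v = phi a v + phi b v
    & forall a b v, phi (a * i b) v = phi a (b *: v)].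

Definition is_tensor (T : lmodType A) (tau : A -> V -> T) : Prop :=
  [/\ balanced tau,
      forall a b v, tau (a * b) v = a *: tau b v
    & forall (M : zmodType) (phi : A -> V -> M), balanced phi ->
        exists2 f : {additive T -> M}, forall a v, f (tau a v) = phi a v
        & forall f' : {additive T -> M},
            (forall a v, f' (tau a v) = phi a v) -> f' =1 f].

End Tensor.

Section Gradings.
Variable N : nat.

Definition is_grading (M : zmodType) (Md : Z2 N -> {pred M}) : Prop :=
  (forall c, zmod_closed (Md c)) /\
  forall x, exists! w : {ffun Z2 N -> M},
    (forall c, w c \in Md c) /\ x = \sum_c w c.

Definition graded_algebra (K D : pzRingType) (sc : K -> D -> D)
    (Dd : Z2 N -> {pred D}) : Prop :=
  [/\ is_grading Dd, 1 \in Dd 0,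
      forall c d x y, x \in Dd c -> y \in Dd d -> x * y \in Dd (c + d)
    & forall c k x, x \in Dd c -> sc k x \in Dd c].

Definition graded_division (D : pzRingType) (Dd : Z2 N -> {pred D}) : Prop :=
  forall c x, x \in Dd c -> x != 0 -> exists y, x * y = 1 /\ y * x = 1.

Definition mxdeg (D : pzRingType) (Dd : Z2 N -> {pred D}) (n : nat)
    (cbar : n.-tuple (Z2 N)) (c : Z2 N) : {pred 'M[D]_n} :=
  [pred B : 'M[D]_n | [forall k, forall j,
     B k j \in Dd (tnth cbar k + c - tnth cbar j)]].

Section GradedModules.
Variables (A : pzRingType) (Ad : Z2 N -> {pred A}).

Definition graded_module (T : lmodType A) (Td : Z2 N -> {pred T}) : Prop :=
  is_grading Td /\
  forall c d a t, a \in Ad c -> t \in Td d -> a *: t \in Td (c + d).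

Definition graded_submodule (T : lmodType A) (Td : Z2 N -> {pred T})
    (S : {pred T}) : Prop :=
  submod_closed S /\
  forall w : Z2 N -> T, (forall c, w c \in Td c) -> \sum_c w c \in S ->
    forall c, w c \in S.

Definition simple_graded (T : lmodType A) (Td : Z2 N -> {pred T}) : Prop :=
  [/\ graded_module Td, exists t : T, t != 0
    & forall S, graded_submodule Td S -> S =i pred1 0 \/ S =i predT].

Definition shift (T : lmodType A) (Td : Z2 N -> {pred T}) (c : Z2 N) :
  Z2 N -> {pred T} := fun c' => Td (c' + c).

Definition giso (T W : lmodType A) (Td : Z2 N -> {pred T})
    (Wd : Z2 N -> {pred W}) : Prop :=
  exists2 f : {linear T -> W}, bijective f
    & forall c t, (f t \in Wd c) = (t \in Td c).

End GradedModules.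

Definition end_deg (K : comNzRingType) (A : algType K) (T : lmodType A)
    (Td : Z2 N -> {pred T}) (c : Z2 N) : {pred gend T} :=
  [pred phi : gend T | `[< forall d t, t \in Td d -> phi t \in Td (d + c) >]].

End Gradings.

Record z2hom (gT : finGroupType) (N : nat) := Z2Hom {
  z2deg :> gT -> Z2 N;
  z2degM : {morph z2deg : g h / (g * h)%g >-> g + h};
  z2deg_surj : forall c, exists g, z2deg g = c }.

Definition gact (R : realType) (gT : finGroupType) (N : nat) (p : z2hom gT N)
    (s : {additive Z2 N -> 'F_2}) (g : gT) (x : R[i]) : R[i] :=
  if s (p g) == 0 then x else x^*.

Record cocycle (R : realType) (gT : finGroupType) (N : nat) (p : z2hom gT N)
    (s : {additive Z2 N -> 'F_2}) := Cocycle {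
  cocycle_fun :> gT -> gT -> R[i];
  cocycle_norm : forall g h, `|cocycle_fun g h| = 1;
  cocycleP : forall g h k,
    cocycle_fun g h * cocycle_fun (g * h)%g k =
    gact p s g (cocycle_fun h k) * cocycle_fun g (h * k)%g;
  cocycle1g : forall g, cocycle_fun 1%g g = 1;
  cocycleg1 : forall g, cocycle_fun g 1%g = 1 }.

(* C[G, omega, s]: the element sum_g a(g) g is the function a. *)
Definition twalg (R : realType) (gT : finGroupType) (N : nat) (p : z2hom gT N)
  (s : {additive Z2 N -> 'F_2}) (om : cocycle R p s) : Type := {ffun gT -> R[i]}.

Section TwistedAlgebra.
Variables (R : realType) (gT : finGroupType) (N : nat) (p : z2hom gT N).
Variables (s : {additive Z2 N -> 'F_2}) (om : cocycle R p s).
Implicit Types (g h k : gT) (x y : R[i]).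

Local Notation act := (@gact R gT N p s).
Local Notation C := (R[i]).
Local Notation A := (twalg om).

Fact gact_additive g : additive (act g).
Proof. by move=> x y; rewrite /gact; case: ifP => // _; rewrite rmorphB. Qed.

Fact gact_multiplicative g : multiplicative (act g).
Proof.
rewrite /gact; split => [x y|]; case: ifP => // _;
  by rewrite ?rmorphM ?rmorph1.
Qed.

HB.instance Definition _ g := GRing.isAdditive.Build C C (act g) (gact_additive g).
HB.instance Definition _ g :=
  GRing.isMultiplicative.Build C C (act g) (gact_multiplicative g).

Lemma z2deg1 : p 1%g = 0.
Proof. by apply: (addrI (p 1%g)); rewrite -z2degM mulg1 addr0. Qed.

Lemma gact1 x : act 1%g x = x.
Proof. by rewrite /gact z2deg1 raddf0 eqxx. Qed.

Lemma gactM g h x : act (g * h)%g x = act g (act h x).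
Proof.
rewrite /gact z2degM raddfD.
case: (s (p g)) => [[|[|//]] ?]; case: (s (p h)) => [[|[|//]] ?] //=.
exact: esym (conjCK x).
Qed.

Lemma gactK g : involutive (act g).
Proof. by move=> x; rewrite /gact; case: (_ == 0) => //; apply: conjCK. Qed.

HB.instance Definition _ := GRing.Zmodule.copy A {ffun gT -> C}.


Implicit Types a b : A.

Definition twalg_one : A := [ffun k : gT => (k == 1%g)%:R].

Definition twalg_mul a b : A := [ffun k : gT =>
  \sum_g a g * act g (b (g^-1 * k)%g) * om g (g^-1 * k)%g].

Lemma twalg_mulA : associative twalg_mul.
Proof.
move=> a b c; apply/ffunP => k; rewrite !ffunE.
under eq_bigr => g _.
  rewrite ffunE rmorph_sum mulr_sumr mulr_suml.
  rewrite (reindex_inj (mulgI g^-1%g)) /=.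
  over.
rewrite exchange_big /=; apply: eq_bigr => h _.
rewrite ffunE !mulr_suml; apply: eq_bigr => g _.
have -> : ((g^-1 * h)^-1 * (g^-1 * k) = h^-1 * k)%g.
  by rewrite invMg invgK -mulgA mulKVg.
have := cocycleP om g (g^-1 * h)%g (h^-1 * k)%g.
rewrite mulKVg -mulgA mulKVg => e.
rewrite !rmorphM /= -gactM mulKVg -!mulrA; congr (_ * (_ * _)).
by rewrite -e mulrCA.
Qed.

Lemma twalg_mul1 : left_id twalg_one twalg_mul.
Proof.
move=> a; apply/ffunP => k; rewrite ffunE (bigD1 1%g) //= big1 => [|g gn1].
  by rewrite ffunE eqxx gact1 invg1 mul1g cocycle1g mul1r mulr1 addr0.
by rewrite ffunE (negPf gn1) !mul0r.
Qed.

Lemma twalg_1mul : right_id twalg_one twalg_mul.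
Proof.
move=> a; apply/ffunP => k; rewrite ffunE (bigD1 k) //= big1 => [|g gnk].
  by rewrite ffunE mulVg eqxx rmorph1 cocycleg1 !mulr1 addr0.
by rewrite ffunE -eq_mulVg1 (negPf gnk) rmorph0 mulr0 mul0r.
Qed.

Lemma twalg_mulDl : left_distributive twalg_mul +%R.
Proof.
move=> a b c; apply/ffunP => k; rewrite !ffunE -big_split /=.
by apply: eq_bigr => g _; rewrite !ffunE !mulrDl.
Qed.

Lemma twalg_mulDr : right_distributive twalg_mul +%R.
Proof.
move=> a b c; apply/ffunP => k; rewrite !ffunE -big_split /=.
by apply: eq_bigr => g _; rewrite !ffunE rmorphD mulrDr mulrDl.
Qed.

Lemma twalg_one_neq0 : twalg_one != 0.
Proof.
by apply/eqP => /ffunP/(_ 1%g)/eqP; rewrite !ffunE eqxx oner_eq0.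
Qed.

HB.instance Definition _ := GRing.Zmodule_isNzRing.Build A
  twalg_mulA twalg_mul1 twalg_1mul twalg_mulDl twalg_mulDr twalg_one_neq0.

(* The basis element g and the scalar x 1; a scalar times a group element is
   thus twC x * twb g. *)
Definition twb g : A := [ffun k : gT => (k == g)%:R].
Definition twC x : A := [ffun k : gT => if k == 1%g then x else 0].

Lemma twCM_coef x a k : (twC x * a) k = x * a k.
Proof.
rewrite ffunE (bigD1 1%g) //= big1 => [|g gn1].
  by rewrite ffunE eqxx gact1 invg1 mul1g cocycle1g mulr1 addr0.
by rewrite ffunE (negPf gn1) !mul0r.
Qed.

Fact twC_additive : additive twC.
Proof.
by move=> x y; apply/ffunP => k; rewrite !ffunE; case: ifP; rewrite ?subr0.
Qed.

Fact twC_multiplicative : multiplicative twC.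
Proof.
split=> [x y|]; apply/ffunP => k; last by rewrite !ffunE; case: ifP.
by rewrite twCM_coef !ffunE; case: ifP; rewrite ?mulr0.
Qed.

HB.instance Definition _ := GRing.isAdditive.Build C A twC twC_additive.
HB.instance Definition _ :=
  GRing.isMultiplicative.Build C A twC twC_multiplicative.

Lemma twbM g h : twb g * twb h = twC (om g h) * twb (g * h)%g.
Proof.
apply/ffunP => k; rewrite twCM_coef ffunE (bigD1 g) //= big1 => [|g' gn].
  rewrite !ffunE eqxx mul1r addr0 -(inj_eq (mulgI g)) mulKVg.
  by case: eqP => [->|_]; rewrite ?rmorph0 ?rmorph1 ?mulr0 ?mul0r // mul1r mulKg mulr1.
by rewrite ffunE (negPf gn) !mul0r.
Qed.

Lemma twbC g x : twb g * twC x = twC (act g x) * twb g.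
Proof.
apply/ffunP => k; rewrite twCM_coef ffunE (bigD1 g) //= big1 => [|g' gn].
  rewrite !ffunE eqxx mul1r addr0 -eq_mulVg1 eq_sym.
  by case: eqP => [->|_]; rewrite ?rmorph0 ?mulr0 ?mul0r // mulVg cocycleg1.
by rewrite ffunE (negPf gn) !mul0r.
Qed.

Lemma twb1 : twb 1%g = 1.
Proof. by []. Qed.

Lemma twalgE a : a = \sum_g twC (a g) * twb g.
Proof.
apply/ffunP => k; rewrite sum_ffunE (bigD1 k) //= big1 => [|g gn].
  by rewrite twCM_coef ffunE eqxx mulr1 addr0.
by rewrite twCM_coef ffunE eq_sym (negPf gn) mulr0.
Qed.

(* C is not central in C[G, omega, s] when s != 0, but its real subfield is. *)
Definition twalg_scale (x : R) a : A := twC (x%:C)%C * a.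

Lemma twalg_scaleA (x y : R) a :
  twalg_scale x (twalg_scale y a) = twalg_scale (x * y) a.
Proof. by rewrite /twalg_scale mulrA -!rmorphM. Qed.

Lemma twalg_scale1 : left_id 1 twalg_scale.
Proof. by move=> a; rewrite /twalg_scale !rmorph1 mul1r. Qed.

Lemma twalg_scaleDr : right_distributive twalg_scale +%R.
Proof. by move=> x a b; apply: mulrDr. Qed.

Lemma twalg_scaleDl a : {morph twalg_scale^~ a : x y / x + y}.
Proof. by move=> x y; rewrite /twalg_scale !rmorphD mulrDl. Qed.

HB.instance Definition _ := GRing.Zmodule_isLmodule.Build R A
  twalg_scaleA twalg_scale1 twalg_scaleDr twalg_scaleDl.

Fact twalg_scaleAl (x : R) a b : x *: (a * b) = (x *: a) * b.
Proof. exact: mulrA. Qed.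

HB.instance Definition _ := GRing.Lmodule_isLalgebra.Build R A twalg_scaleAl.

Lemma gact_real g (x : R) : act g (x%:C)%C = (x%:C)%C.
Proof. by rewrite /gact; case: ifP => // _; apply: conjc_real. Qed.

Fact twalg_scaleAr (x : R) a b : x *: (a * b) = a * (x *: b).
Proof.
rewrite /GRing.scale /= /twalg_scale !mulrA; congr (_ * _).
rewrite {1 2}(twalgE a) mulr_sumr mulr_suml; apply: eq_bigr => g _.
by rewrite -mulrA twbC gact_real !mulrA -!rmorphM /= mulrC.
Qed.

HB.instance Definition _ := GRing.Lalgebra_isAlgebra.Build R A twalg_scaleAr.

(* a is in the C-span of G_c iff it is supported on G_c. *)
Definition twdeg (c : Z2 N) : {pred A} :=
  [pred a : A | [forall g, (a g != 0) ==> (p g == c)]].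

Lemma twdegP c a : reflect (forall g, a g != 0 -> p g = c) (a \in twdeg c).
Proof.
apply: (iffP forallP) => h g; last by apply/implyP => /h ->.
by move=> ag; have /implyP/(_ ag)/eqP := h g.
Qed.

Lemma twdegZb c x g : p g = c -> twC x * twb g \in twdeg c.
Proof.
move=> pg; apply/twdegP => h; rewrite twCM_coef ffunE.
by case: (h =P g) => [->//|_]; rewrite mulr0 eqxx.
Qed.

Fact twdeg_zmod c : zmod_closed (twdeg c).
Proof.
split=> [|a b /twdegP ha /twdegP hb]; apply/twdegP => g; rewrite !ffunE.
  by rewrite eqxx.
have [ag|/ha //] := eqVneq (a g) 0; have [bg|/hb //] := eqVneq (b g) 0.
by rewrite ag bg subrr eqxx.
Qed.

Lemma twdeg_sum c (I : finType) (F : I -> A) :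
  (forall i, F i \in twdeg c) -> \sum_i F i \in twdeg c.
Proof.
move=> h; apply: (big_ind (fun a => a \in twdeg c)) => [|a b|i _]; last exact: h.
- by have [] := twdeg_zmod c.
- by move=> ha hb; case: (GRing.zmod_closedD (twdeg_zmod c)) => _ hD; apply: hD.
Qed.

Lemma twdegM c d a b : a \in twdeg c -> b \in twdeg d -> a * b \in twdeg (c + d).
Proof.
move=> /twdegP ha /twdegP hb; apply/twdegP => k; rewrite ffunE => k0.
have [g] : exists g, a g * act g (b (g^-1 * k)%g) * om g (g^-1 * k)%g != 0.
  apply/existsP; apply: contraNT k0; rewrite negb_exists => /forallP h.
  by rewrite big1 // => g _; apply/eqP; have := h g; rewrite negbK.
rewrite !mulf_eq0 !negb_or fmorph_eq0 => /andP[/andP[/ha pa /hb pb] _].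
by rewrite -pa -pb -z2degM mulKVg.
Qed.

Lemma twdeg1 : 1 \in twdeg 0.
Proof.
apply/twdegP => g; rewrite ffunE.
by case: (g =P 1%g) => [-> _|_]; [exact: z2deg1 | rewrite eqxx].
Qed.

Fact twdeg0_subring : subring_closed (twdeg 0).
Proof.
split; [exact: twdeg1 | by case: (twdeg_zmod 0) |].
by move=> a b ha hb; rewrite -[0]addr0; apply: twdegM.
Qed.

HB.instance Definition _ := GRing.isSubringClosed.Build A (twdeg 0) twdeg0_subring.

Fact twC_deg0 x : twC x \in twdeg 0.
Proof. by rewrite -[twC x]mulr1 -twb1; apply/twdegZb/z2deg1. Qed.

Lemma twalg_graded : graded_algebra (fun (x : R) a => x *: a) twdeg.
Proof.
split; [|exact: twdeg1 | exact: twdegM |]; last first.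
  by move=> c x a ha; rewrite -[c]add0r; apply: twdegM; first exact: twC_deg0.
split=> [|a]; first exact: twdeg_zmod.
exists [ffun c => [ffun k => if p k == c then a k else 0] : A]; split; first split.
- move=> c; rewrite ffunE; apply/twdegP => g; rewrite ffunE.
  by case: (p g =P c) => // _; rewrite eqxx.
- apply/ffunP => k; rewrite sum_ffunE (bigD1 (p k)) //= big1 => [|c cn].
    by rewrite !ffunE eqxx addr0.
  by rewrite !ffunE eq_sym (negPf cn).
- move=> w [hw ->]; apply/ffunP => c; rewrite ffunE; apply/ffunP => k.
  have w0 d : d != p k -> w d k = 0.
    by move=> dk; apply: contraNeq dk => /(twdegP _ _ (hw d)) ->.
  rewrite ffunE; case: (p k =P c) => [<-|/eqP pk]; last by rewrite w0 // eq_sym.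
  by rewrite sum_ffunE (bigD1 (p k)) //= big1 ?addr0 // => d /w0.
Qed.

(* C[G_0, omega] is realised as the degree-0 subring. *)
Definition twalg0 : Type := {a : A | a \in twdeg 0}.
Local Notation A0 := twalg0.

HB.instance Definition _ := [isSub of A0 for @sval A (fun a => a \in twdeg 0)].
HB.instance Definition _ := [Choice of A0 by <:].
HB.instance Definition _ := [SubChoice_isSubNzRing of A0 by <:].

Definition twincl : {rmorphism A0 -> A} := \val.

Definition twC0 x : A0 := exist _ (twC x) (twC_deg0 x).

Fact twC0_additive : additive twC0.
Proof. by move=> x y; apply: val_inj; rewrite /= [LHS]rmorphB. Qed.

Fact twC0_multiplicative : multiplicative twC0.
Proof. by split=> [x y|]; apply: val_inj; rewrite /= ?rmorphM ?rmorph1. Qed.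

HB.instance Definition _ := GRing.isAdditive.Build C A0 twC0 twC0_additive.
HB.instance Definition _ :=
  GRing.isMultiplicative.Build C A0 twC0 twC0_multiplicative.

(* The basis element g of C[G_0, omega]; junk value 0 when g is not in G_0. *)
Definition twb0 g : A0 := insubd 0 (twb g).

Lemma twb0E g : p g = 0 -> twincl (twb0 g) = twb g.
Proof.
by move=> pg; rewrite /= insubdK // -[twb g]mul1r -(rmorph1 twC); apply: twdegZb.
Qed.

Definition nu (g1 g2 g3 : gT) : C :=
  (act g1 (om g1 g1^-1%g))^-1 * act g1 (om g2 g3) * om g1^-1%g (g2 * g3)%g.

Lemma cocycle_neq0 g h : om g h != 0.
Proof. by rewrite -normr_eq0 cocycle_norm oner_eq0. Qed.

(* The defining property of nu: g1^-1 . g2 . g3 = nu(g1, g2, g3) g1^-1g2g3 *)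
Lemma nuP (g1 g2 g3 : gT) :
  twb g1 * (twC (nu g1 g2 g3) * twb (g1^-1 * g2 * g3)%g) = twb g2 * twb g3.
Proof.
rewrite mulrA twbC -mulrA twbM [RHS]twbM mulrA -rmorphM -mulgA mulKVg.
congr (twC _ * _); rewrite /nu !rmorphM fmorphV /= !gactK.
have := cocycleP om g1 g1^-1%g (g2 * g3)%g.
rewrite mulgV cocycle1g mulr1 => e.
by rewrite -mulrA -e mulrAC mulVf ?mul1r // cocycle_neq0.
Qed.

Lemma twb_lreg g : GRing.lreg (twb g).
Proof.
have e : twC (om g^-1%g g)^-1 * twb g^-1%g * twb g = 1.
  by rewrite -mulrA twbM mulVg twb1 mulr1 -rmorphM mulVf ?rmorph1 ?cocycle_neq0.
move=> a b /(congr1 ( *%R (twC (om g^-1%g g)^-1 * twb g^-1%g))).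
by rewrite !mulrA e !mul1r.
Qed.

(* The endomorphism  z h |-> (^g z) nu(g, h, g) g^-1hg  of C[G_0, omega] along
   which V is pulled back to V^g; it is conjugation by g in the algebra. *)
Definition twconj g a : A :=
  \sum_h twC (act g (a h) * nu g h g) * twb (g^-1 * h * g)%g.

Lemma twconjE g a : twb g * twconj g a = a * twb g.
Proof.
rewrite mulr_sumr [in RHS](twalgE a) mulr_suml; apply: eq_bigr => h _.
by rewrite rmorphM -[in RHS]mulrA -(nuP g h g) !mulrA twbC /= gactK.
Qed.

Fact twconj_deg0 g (a : A0) : twconj g (twincl a) \in twdeg 0.
Proof.
apply: twdeg_sum => h; have [a0|/(twdegP _ _ (valP a)) ph] := eqVneq (val a h) 0.
  rewrite /= a0 rmorph0 mul0r rmorph0 mul0r.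
  by have [] := twdeg_zmod 0.
apply: twdegZb; rewrite !z2degM ph addr0 -z2degM mulVg; exact: z2deg1.
Qed.

Definition twconj0 g (a : A0) : A0 :=
  exist _ (twconj g (twincl a)) (twconj_deg0 g a).

Fact twconj0_additive g : additive (twconj0 g).
Proof.
move=> a b; apply: val_inj; rewrite [RHS]rmorphB; apply: (@twb_lreg g).
by rewrite mulrBr !twconjE rmorphB mulrBl.
Qed.

Fact twconj0_multiplicative g : multiplicative (twconj0 g).
Proof.
split=> [a b|]; apply: val_inj; apply: (@twb_lreg g).
  rewrite [in RHS]rmorphM.
  by rewrite mulrA !twconjE rmorphM -mulrA twconjE mulrA.
by rewrite twconjE !rmorph1 mul1r mulr1.
Qed.

HB.instance Definition _ g :=
  GRing.isAdditive.Build A0 A0 (twconj0 g) (twconj0_additive g).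
HB.instance Definition _ g :=
  GRing.isMultiplicative.Build A0 A0 (twconj0 g) (twconj0_multiplicative g).

Definition conjmod (V : lmodType A0) g : lmodType A0 := restr (twconj0 g) V.

End TwistedAlgebra.

Arguments twdeg {R gT N p s} om c.

Section Induced.
Variables (R : realType) (gT : finGroupType) (N : nat) (p : z2hom gT N).
Variables (s : {additive Z2 N -> 'F_2}) (om : cocycle R p s).
Variables (V : lmodType (twalg0 om)) (T : lmodType (twalg om)).
Variables (tau : twalg om -> V -> T) (gc : Z2 N -> gT).

(* The degree-c part of A (x) V is spanned by the a (x) v with a in A_c. *)
Definition tdeg (c : Z2 N) : {pred T} := [pred t : T |
  `[< exists n (a : 'I_n -> twalg om) (v : 'I_n -> V),
        (forall j, a j \in twdeg om c) /\ t = \sum_j tau (a j) (v j) >]].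

(* The subset g (x) V of A (x) V. *)
Definition gtens (g : gT) : {pred T} :=
  [pred t : T | `[< exists v : V, t = tau (twb om g) v >]].

(* The identification of (+)_c V with A (x) V. *)
Definition bsum (w : Z2 N -> V) : T := \sum_c tau (twb om (gc c)) (w c).

Definition blockop (M : Z2 N -> Z2 N -> V -> V) (w : Z2 N -> V) : Z2 N -> V :=
  fun c => \sum_c' M c c' (w c').

Definition has_blocks (phi : T -> T) (M : Z2 N -> Z2 N -> V -> V) : Prop :=
  forall w, phi (bsum w) = bsum (blockop M w).

Definition rhoC (x : R[i]) (c c' : Z2 N) (v : V) : V :=
  if c == c' then twC0 om (gact p s (gc c) x) *: v else 0.

Definition rhoG (g : gT) (c c' : Z2 N) (v : V) : V :=
  if c == c' + p g then
    twC0 om (nu om (gc c) g (gc c')) *: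
      (twb0 om ((gc c)^-1 * g * gc c')%g *: v)
  else 0.

Definition diagC (x : R[i]) (c c' : Z2 N) (v : V) : V :=
  if c == c' then twC0 om x *: v else 0.

Definition theta_block (z : Z2 N) (f : V -> V) (c c' : Z2 N) (v : V) : V :=
  if c == c' + z then
    twC0 om (nu om (gc c) (gc c') (gc z)) *:
      (twb0 om ((gc c)^-1 * gc c' * gc z)%g *: f v)
  else 0.

End Induced.

Section Stabilizer.
Variables (R : realType) (gT : finGroupType) (N : nat) (p : z2hom gT N).
Variables (s : {additive Z2 N -> 'F_2}) (om : cocycle R p s).
Variable gc : Z2 N -> gT.

Definition stab (V : lmodType (twalg0 om)) : {set Z2 N} :=
  [set c | `[< lmod_iso (conjmod V (gc c)) V >]].

(* A complete irredundant list of representatives of the simple modules under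
   V ~ W iff V is isomorphic to W^(g_c) for some c. *)
Definition simple_reps (I : finType) (V : I -> lmodType (twalg0 om)) : Prop :=
  [/\ forall i, simple_module (V i),
      forall W : lmodType (twalg0 om), simple_module W ->
        exists i c, lmod_iso (V i) (conjmod W (gc c))
    & forall i j c, lmod_iso (V i) (conjmod (V j) (gc c)) -> i = j].

End Stabilizer.

Definition cosets N (E : {set Z2 N}) : {set {set Z2 N}} :=
  equivalence_partition (fun c c' => c' - c \in E) [set: Z2 N].

Definition generates (D : pzRingType) (X : D -> Prop) : Prop :=
  forall S : {pred D}, subring_closed S -> (forall x, X x -> x \in S) ->
  S =i predT.

(* The basis z of the subspace U is adapted to s. *)
Definition adapted N (s : Z2 N -> 'F_2) (U : {vspace Z2 N}) r
    (z : r.-tuple (Z2 N)) : Prop :=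
  basis_of U z /\
  ((exists2 c, c \in U & s c != 0) ->
   forall i : 'I_r, s (tnth z i) = (i == 0%N :> nat)%:R).

(* Main.v *)
(* The twisted group algebra A is graded by Z_2^N and every A_c contains the unit
   g_c, so A (x) V is the direct sum of the g_c (x) V and its A-linear maps of
   degree c into a graded module M are the A_0-linear maps V -> M_c.  For M_c =
   g_c (x) V this identifies D_c with Hom(V, V^{g_c}).  Schur's lemma for simple
   graded modules then makes D a graded division algebra, and an eigenvector of a
   degree-0 endomorphism gives D_0 = C; as D_c is a line over D_0 for c in E, D is
   generated by one invertible element per basis vector of E, and theta_i^2 and
   the commutators of the theta_i are scalars.

   For (3), averaging a projection onto a graded left ideal (Maschke) shows that 1
   is a sum of elements of minimal graded left ideals.  Each of these is, up to a
   shift, one of the induced modules, so there are finitely many, they are jointly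
   faithful, and every family of maps commuting with the D_i is given by an element
   of A.  The matrices of A in homogeneous D_i-bases of the induced modules
   therefore give the isomorphism Phi. *)

Require Import Defs.
From mathcomp Require Import all_boot all_order all_algebra all_fingroup.
From mathcomp Require Import boolp reals complex.
From HB Require Import structures.

Set Implicit Arguments.
Unset Strict Implicit.
Unset Printing Implicit Defensive.

Import GRing.Theory Num.Theory.
Local Open Scope ring_scope.

(** The tensor product is given only by its universal property and V is an arbitrary module, so
    coordinates on A (x) V and finite dimension must be derived: the former from A being the direct
    sum of the g_c A_0, the latter because a simple V = A_0 v is spanned over C by finitely many g
    v. The recurring obstacle is that C need not be central in A. It is central in A_0, as s(0) = 0;
    hence eigenvalues are taken on V and not on A (x) V, and an endomorphism of degree c commutes
    with scalars only up to conjugation by g_c. In the averaging argument g may be antilinear, but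
    g^-1 pi g is again C-linear. The factors nu enter in one place, where g1 g2 is rewritten as g_c
    b with b in A_0. Facts about V^(g_c) that would need further cocycle computations, such as E
    being a subspace or ~ being an equivalence relation, are read off from homogeneous maps between
    induced modules. The opposite algebra appears because A acts by D-linear maps on the left
    D-module A (x) V. *)

Definition lin_of (A : pzRingType) (V W : lmodType A) (f : V -> W) (fL : linear f) :
  {linear V -> W} := HB.pack f (GRing.isLinear.Build A V W _ _ fL).

(** * Submodules, dimension and eigenvectors *)

Section Modules.
Variable A : pzRingType.
Implicit Types V W X : lmodType A.

Lemma linear_bij_inv V W (f : {linear V -> W}) : bijective f ->
  exists2 g : {linear W -> V}, cancel f g & cancel g f.
Proof. by case=> g fK gK; exists (lin_of (can2_linear fK gK)). Qed.

Lemma lmod_iso_sym V W : lmod_iso V W -> lmod_iso W V.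
Proof. by case=> f /linear_bij_inv[g fK gK]; exists g, f. Qed.

Lemma lmod_iso_trans V W X : lmod_iso V W -> lmod_iso W X -> lmod_iso V X.
Proof. by case=> f bf [g bg]; exists (g \o f); apply: bij_comp. Qed.

Lemma lker_submod V W (f : {linear V -> W}) :
  submod_closed [pred v : V | f v == 0].
Proof.
split=> [|a u v /eqP fu /eqP fv]; rewrite inE ?linear0 //.
by rewrite linearP fu fv scaler0 addr0.
Qed.

Lemma injective_of_kernel (V W : zmodType) (f : {additive V -> W}) :
  (forall v, f v = 0 -> v = 0) -> injective f.
Proof. by move=> h u v e; apply/eqP; rewrite -subr_eq0 (h (u - v)) // raddfB e subrr. Qed.

Lemma bijective_surj (T1 T2 : Type) (f : T1 -> T2) :
  injective f -> (forall y, exists x, y = f x) -> bijective f.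
Proof.
move=> fI fS; pose g y := sval (cid (fS y)).
have gK : cancel g f by move=> y; rewrite /g; case: cid => x /= <-.
by exists g => // x; apply: fI; rewrite gK.
Qed.

Lemma simple_iso V W : lmod_iso V W -> simple_module V -> simple_module W.
Proof.
case=> f /linear_bij_inv[g fK gK] [[v v0] sV]; split.
  by exists (f v); rewrite -(linear0 f) (can_eq fK).
move=> S [S0 SD]; case: (sV [pred v | f v \in S]) => [|h|h].
- by split=> [|a x y]; rewrite !inE ?linear0 // linearP; apply: SD.
- left=> w; rewrite -[w]gK; have := h (g w); rewrite !inE => ->.
  by rewrite -[in RHS](linear0 f) (can_eq fK).
- by right=> w; rewrite -[w]gK; have := h (g w); rewrite !inE => ->.
Qed.

Lemma submod_sum V (S : {pred V}) (I : Type) (r : seq I) (P : pred I) (F : I -> V) :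
  submod_closed S -> (forall i, P i -> F i \in S) -> \sum_(i <- r | P i) F i \in S.
Proof.
move=> [S0 SD] h; apply: (big_ind (fun x => x \in S)) => // x y hx hy.
by rewrite -[x]scale1r; apply: SD.
Qed.

Lemma submodZ V (S : {pred V}) a x : submod_closed S -> x \in S -> a *: x \in S.
Proof. by move=> [S0 SD] hx; rewrite -[_ *: _]addr0; apply: SD. Qed.

Lemma submodD V (S : {pred V}) x y : submod_closed S ->
  x \in S -> y \in S -> x + y \in S.
Proof. by move=> [S0 SD] hx hy; rewrite -[x]scale1r; apply: SD. Qed.

Lemma submodB V (S : {pred V}) x y : submod_closed S ->
  x \in S -> y \in S -> x - y \in S.
Proof.
by move=> SS hx hy; apply: submodD => //; rewrite -scaleN1r; apply: submodZ.
Qed.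

End Modules.

(** Bundling the closure proof with the predicate gives the instances below a key, so that every
    submodule becomes a module type [subT]. *)
Record submod (A : pzRingType) (V : lmodType A) := Submod {
  submod_pred :> {pred V};
  submodP : submod_closed submod_pred }.

Section Submodules.
Variables (A : pzRingType) (V : lmodType A) (S : submod V).

HB.instance Definition _ := GRing.isSubmodClosed.Build A V (submod_pred S) (submodP S).

Definition subT : Type := {x : V | x \in submod_pred S}.

HB.instance Definition _ := [isSub of subT for @sval V (fun x => x \in submod_pred S)].
HB.instance Definition _ := [Choice of subT by <:].
HB.instance Definition _ := [SubChoice_isSubLmodule of subT by <:].

Definition subT_incl : {linear subT -> V} := \val.

End Submodules.

(** A subspace of largest dimension among those contained in S is all of S: the line of a further
    vector of S could be added to it. *)
Lemma submod_vspace (K : fieldType) (vT : vectType K) (S : {pred vT}) :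
  submod_closed S -> exists U : {vspace vT}, U =i S.
Proof.
move=> SS.
pose P d := `[< exists U : {vspace vT}, {subset U <= S} /\ \dim U = d >].
have P0 : exists d, P d.
  exists 0; apply/asboolP; exists 0%VS; rewrite dimv0; split=> // x.
  by rewrite memv0 => /eqP->; case: SS.
have Pb d : P d -> (d <= \dim {:vT})%N.
  by move=> /asboolP[U [_ <-]]; apply/dimvS/subvf.
case: (ex_maxnP P0 Pb) => d /asboolP[U [US <-]] Umax; exists U => x.
apply/idP/idP => [/US//|xS]; apply: contraT => xU.
have /Umax : P (\dim (U + <[x]>)).
  apply/asboolP; exists (U + <[x]>)%VS; split=> // y /memv_addP[u uU [w /vlineP[k ->] ->]].
  by apply: submodD => //; [apply: US | apply: submodZ].
rewrite (geq_leqif (dimv_leqif_sup (addvSl U <[x]>))) => /subvP/(_ x) h.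
by move: xU; rewrite h // -{1}[x]add0r memv_add ?mem0v ?memv_line.
Qed.

Definition fbasis (K : pzRingType) (V : lmodType K) (I : finType) (e : I -> V) :=
  forall v, exists! x : {ffun I -> K}, v = \sum_i x i *: e i.

Lemma fbasis_dim (K : pzRingType) (V : lmodType K) (I : finType) (e : I -> V) :
  fbasis e -> has_dim V #|I|.
Proof.
move=> eB; exists (e \o enum_val) => v; have [x [-> xU]] := eB v.
exists [ffun i => x (enum_val i)]; split=> [|y yE].
  rewrite (reindex_onto (@enum_val I I) enum_rank) => [|i _]; last exact: enum_rankK.
  by apply: eq_big => [i|i _]; rewrite ?enum_valK ?eqxx ?ffunE.
have {xU} -> : x = [ffun i => y (enum_rank i)].
  apply: xU; rewrite yE (reindex_onto enum_rank enum_val) => [|i _]; last exact: enum_valK.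
  by apply: eq_big => [i|i _]; rewrite ?enum_rankK ?eqxx ?ffunE //= enum_rankK.
by apply/ffunP => i; rewrite !ffunE enum_valK.
Qed.

Section Dimension.
Variables (K : fieldType) (V : lmodType K).

(** A spanning family of least length is a basis: two different expansions of a vector give a
    relation with a nonzero coefficient, which eliminates one member. *)
Lemma has_dim_span (I : finType) (e : I -> V) :
  (forall v, exists x : I -> K, v = \sum_i x i *: e i) -> exists n, has_dim V n.
Proof.
pose P n := `[< exists e : 'I_n -> V,
  forall v, exists x : 'I_n -> K, v = \sum_i x i *: e i >].
move=> espan; have : exists n, P n.
  exists #|I|; apply/asboolP; exists (e \o enum_val) => v; have [x ->] := espan v.
  exists (x \o enum_val).
  rewrite (reindex_onto (@enum_val I I) enum_rank) => [|i _]; last exact: enum_rankK.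
  by apply: eq_bigl => i; rewrite enum_valK eqxx.
move=> /ex_minnP[n /asboolP[{}e {}espan] nmin]; exists n, e => v.
have [x xE] := espan v; exists (finfun x); split=> [|y yE].
  by under eq_bigr do rewrite ffunE.
apply/ffunP => i0; rewrite ffunE; apply/eqP; apply: contraT => nz.
case: n e x y i0 => [|n] e x y [i0 hi0] // in espan nmin xE yE nz *.
move: (Ordinal hi0) nz => {hi0}i0 nz; set d := x i0 - y i0.
have d0 : d != 0 by rewrite subr_eq0.
have ei0 : e i0 = \sum_i (d^-1 * (y (lift i0 i) - x (lift i0 i))) *: e (lift i0 i).
  have : \sum_i (x i - y i) *: e i = 0.
    by under eq_bigr do rewrite scalerBl; rewrite sumrB -xE -yE subrr.
  rewrite (bigD1_ord i0) //= => /(congr1 ( *:%R d^-1)).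
  rewrite scaler0 scalerDr scalerA mulVf // scale1r => /eqP.
  rewrite addr_eq0 => /eqP ->; rewrite scaler_sumr -sumrN; apply: eq_bigr => i _.
  by rewrite scalerA -scaleNr -mulrN opprB.
have /nmin : P n; last by rewrite ltnn.
apply/asboolP; exists (fun i => e (lift i0 i)) => w; have [z ->] := espan w.
exists (fun i => z i0 * (d^-1 * (y (lift i0 i) - x (lift i0 i))) + z (lift i0 i)).
rewrite (bigD1_ord i0) //= {1}ei0 scaler_sumr -big_split /=.
by apply: eq_bigr => i _; rewrite scalerDl scalerA.
Qed.

(** The coordinate vectors are the n+1 rows of a matrix with n columns, whose left kernel is nonzero
    by rank. *)
Lemma has_dim_dependent n (e : 'I_n.+1 -> V) : has_dim V n ->
  exists2 x : 'I_n.+1 -> K, exists i, x i != 0 & \sum_i x i *: e i = 0.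
Proof.
case=> b bB; pose co v : {ffun 'I_n -> K} := sval (cid (bB v)).
have coE v : v = \sum_i co v i *: b i by rewrite /co; case: cid => x /= [].
pose M := \matrix_(i < n.+1, j < n) co (e i) j.
have : kermx M != 0.
  by rewrite kermx_eq0 /row_free neq_ltn ltnS rank_leq_col.
case/rowV0Pn => u /sub_kermxP uM u0; exists (u 0) => [|].
  apply/existsP; apply: contraNT u0; rewrite negb_exists => /forallP h.
  by apply/eqP/rowP => i; rewrite mxE; apply/eqP; have := h i; rewrite negbK.
under eq_bigr => i _ do rewrite [e i]coE scaler_sumr.
rewrite exchange_big big1 //= => j _.
under eq_bigr do rewrite scalerA; rewrite -scaler_suml.
have /rowP/(_ j) := uM; rewrite !mxE => uMj.
by under eq_bigr => i _ do [have -> : co (e i) j = M i j by rewrite mxE]; rewrite uMj scale0r.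
Qed.

End Dimension.

Lemma eigenvector_exists (K : closedFieldType) (V : lmodType K) n (f : {linear V -> V}) :
  has_dim V n -> (exists v : V, v != 0) -> exists a v, v != 0 /\ f v = a *: v.
Proof.
(* Induction on the size of a nonzero polynomial in f that kills some w != 0:
   either f w = a w for a root a, or ('X - a) can be cancelled. *)
move=> dimV [v v0].
pose ev (q : {poly K}) w := \sum_(i < size q) q`_i *: iter i f w.
have evE m (q : {poly K}) w : (size q <= m)%N -> ev q w = \sum_(i < m) q`_i *: iter i f w.
  move=> qm; rewrite /ev (big_ord_widen _ (fun i => q`_i *: iter i f w) qm) big_mkcond.
  by apply: eq_bigr => i _; case: ltnP => // /(nth_default 0) ->; rewrite scale0r.
have evX (q : {poly K}) (a : K) w : ev (q * ('X - a%:P)) w = ev q (f w - a *: w).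
  have sz : (size (q * ('X - a%:P))%R <= (size q).+1)%N.
    apply: leq_trans (size_polyMleq _ _) _.
    by rewrite size_XsubC addn2.
  have iterB i : iter i f (f w - a *: w) = iter i.+1 f w - a *: iter i f w.
    by elim: i => //= i ->; rewrite linearB linearZ.
  rewrite (evE _ _ _ sz) [in RHS]/ev mulrBr.
  under eq_bigr => i _ do rewrite coefB coefMX coefMC scalerBl.
  rewrite sumrB big_ord_recl /= scale0r add0r.
  rewrite [X in _ - X]big_ord_recr /= nth_default // mul0r scale0r addr0.
  rewrite -sumrB; apply: eq_bigr => i _.
  by rewrite iterB scalerBr scalerA.
have : exists m (q : {poly K}), size q = m /\ exists w, [/\ q != 0, w != 0 & ev q w = 0].
  have [x [i xi] xE] := has_dim_dependent (fun i : 'I_n.+1 => iter i f v) dimV.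
  pose q := \poly_(j < n.+1) (if insub j is Some j then x j else 0).
  exists (size q), q; split=> //; exists v; split=> //.
    apply: contraNneq xi => /(congr1 (fun q : {poly K} => q`_i)).
    by rewrite coef_poly ltn_ord valK coef0 => ->.
  rewrite (evE n.+1) ?size_poly // -[RHS]xE; apply: eq_bigr => j _.
  by rewrite coef_poly ltn_ord valK.
case=> m; elim: m => [|m IHm] [q [qm [w [q0 w0 qw]]]].
  by move/eqP: qm; rewrite size_poly_eq0 (negPf q0).
have [/size1_polyC qc|] := leqP (size q) 1.
  rewrite qc polyC_eq0 in q0; move: qw; rewrite qc (evE 1%N) ?size_polyC ?leq_b1 //.
  by rewrite big_ord1 coefC /= => /eqP; rewrite scaler_eq0 (negPf w0) (negPf q0).
move=> q1; have /closed_rootP[a /factor_theorem[q' qE]] : size q != 1 by rewrite gtn_eqF.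
have q'0 : q' != 0 by apply: contraNneq q0 => q'0; rewrite qE q'0 mul0r.
move: qw; rewrite qE evX; have [/eqP|nz] := eqVneq (f w - a *: w) 0.
  by rewrite subr_eq0 => /eqP; exists a, w.
move=> evq'; apply: IHm; exists q'; split; last by exists (f w - a *: w).
by move: qm; rewrite qE size_Mmonic ?monicXsubC // size_XsubC addn2 => -[].
Qed.

(** * Homogeneous projections, and Schur's lemma for graded modules *)

Section Grading.
Variables (N : nat) (M : zmodType) (Md : Z2 N -> {pred M}) (hM : is_grading Md).

(** The projections come out of the [exists!] in [is_grading] by choice. They are computed by
    exhibiting a homogeneous decomposition and applying [gpr_uniq]. *)
Definition gpr (c : Z2 N) (x : M) : M := sval (cid (hM.2 x)) c.

Lemma gpr_mem c x : gpr c x \in Md c.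
Proof. by rewrite /gpr; case: cid => w /= [[]]. Qed.

Lemma gpr_sum x : x = \sum_c gpr c x.
Proof. by rewrite /gpr; case: cid => w /= [[]]. Qed.

Lemma gpr_uniq x (w : Z2 N -> M) :
  (forall c, w c \in Md c) -> x = \sum_c w c -> forall c, gpr c x = w c.
Proof.
move=> hw xE c; rewrite /gpr; case: cid => w' /= [_ wU].
rewrite (wU (finfun w)) ?ffunE //; split=> [d|]; first by rewrite ffunE.
by under eq_bigr do rewrite ffunE.
Qed.

Lemma gmem0 c : 0 \in Md c. Proof. by case: (hM.1 c). Qed.

Lemma gmemB c x y : x \in Md c -> y \in Md c -> x - y \in Md c.
Proof. by case: (hM.1 c) => _; apply. Qed.

Lemma gmemD c x y : x \in Md c -> y \in Md c -> x + y \in Md c.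
Proof. by move=> hx hy; rewrite -[y]opprK -[- y]sub0r !gmemB ?gmem0. Qed.

Lemma gpr_additive c : additive (gpr c).
Proof.
move=> x y; apply: (@gpr_uniq _ (fun c => gpr c x - gpr c y)) => [d|].
  by rewrite gmemB ?gpr_mem.
by rewrite sumrB -!gpr_sum.
Qed.

HB.instance Definition _ c := GRing.isAdditive.Build M M (gpr c) (gpr_additive c).

Lemma gpr_hom c d x : x \in Md d -> gpr c x = if c == d then x else 0.
Proof.
move=> xd; apply: (@gpr_uniq _ (fun c => if c == d then x else 0)) => [e|].
  by case: eqP => [->|_] //; apply: gmem0.
by rewrite -big_mkcond /= big_pred1_eq.
Qed.

Lemma gpr_id c x : x \in Md c -> gpr c x = x.
Proof. by move=> /gpr_hom ->; rewrite eqxx. Qed.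

Lemma gpr_memP c x : reflect (gpr c x = x) (x \in Md c).
Proof. by apply: (iffP idP) => [/gpr_id|<-] //; apply: gpr_mem. Qed.

Lemma gpr_eq0 x : (forall c, gpr c x = 0) -> x = 0.
Proof. by move=> h; rewrite [x]gpr_sum big1. Qed.

Lemma gpr_neq0 x : x != 0 -> exists c, gpr c x != 0.
Proof.
move=> x0; apply/existsP; apply: contraNT x0; rewrite negb_exists => /forallP h.
by apply/eqP/gpr_eq0 => c; apply/eqP; have := h c; rewrite negbK.
Qed.

End Grading.

(** A map of degree c carries a homogeneous decomposition to a homogeneous one, shifted by c.
    Multiplication by a homogeneous element, on either side, is the main instance. *)
Lemma gpr_morph N (M W : zmodType) (Md : Z2 N -> {pred M}) (Wd : Z2 N -> {pred W})
    (hM : is_grading Md) (hW : is_grading Wd) (f : {additive M -> W}) c :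
  (forall d x, x \in Md d -> f x \in Wd (d + c)) ->
  forall d x, gpr hW (d + c) (f x) = f (gpr hM d x).
Proof.
move=> fd d x; rewrite {1}[x](gpr_sum hM) raddf_sum.
rewrite (@gpr_uniq _ _ _ hW _ (fun e => f (gpr hM (e - c) x))) ?addrK // => [e|].
  by rewrite -[e in X in _ \in X](subrK c) fd // gpr_mem.
by rewrite [RHS](reindex_inj (addIr c)); apply: eq_bigr => e _ /=; rewrite addrK.
Qed.

Lemma Z2addrr N (c : Z2 N) : c + c = 0.
Proof. by apply/rowP => i; rewrite !mxE; apply/eqP; case: (c 0 i) => [[|[|]]]. Qed.

Lemma Z2opp N (c : Z2 N) : - c = c.
Proof. by apply/eqP; rewrite eq_sym -addr_eq0 Z2addrr. Qed.

Section GradedModules.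
Variables (N : nat) (A : pzRingType) (Ad : Z2 N -> {pred A}).

Lemma gpr_scale (T : lmodType A) (Td : Z2 N -> {pred T}) (hT : is_grading Td) :
  graded_module Ad Td -> forall c d a t, a \in Ad c ->
  gpr hT (d + c) (a *: t) = a *: gpr hT d t.
Proof.
move=> gT c d a t ha; apply: (gpr_morph hT hT (f := *:%R a)) => e x xe.
by rewrite addrC; apply: gT.2.
Qed.

Lemma gsub_gpr (T : lmodType A) (Td : Z2 N -> {pred T}) (hT : is_grading Td) S :
  graded_submodule Td S -> forall c t, t \in S -> gpr hT c t \in S.
Proof.
case=> _ h c t tS; apply: (h (fun c => gpr hT c t)) => [d|]; first exact: gpr_mem.
by rewrite -gpr_sum.
Qed.

(** Schur's lemma: since f commutes with the projections up to a shift, its kernel and image are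
    graded submodules. *)
Lemma simple_graded_bij (T W : lmodType A) (Td : Z2 N -> {pred T})
    (Wd : Z2 N -> {pred W}) (f : {linear T -> W}) c :
  simple_graded Ad Td -> simple_graded Ad Wd ->
  (forall d t, t \in Td d -> f t \in Wd (d + c)) -> (exists t, f t != 0) ->
  bijective f.
Proof.
move=> [[hT _] _ sT] [[hW _] _ sW] fd [t ft].
have fp d x : gpr hW (d + c) (f x) = f (gpr hT d x) := gpr_morph hT hW fd d x.
apply: bijective_surj.
  apply: injective_of_kernel => x fx.
  case: (sT [pred x | f x == 0]) => [|h|h].
  - split=> [|w wd]; first exact: lker_submod.
    move=> /eqP fw d; rewrite inE; apply/eqP.
    have -> : w d = gpr hT d (\sum_c w c) by rewrite (gpr_uniq hT wd erefl).
    by rewrite -fp fw raddf0.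
  - by apply/eqP; have := h x; rewrite !inE fx eqxx.
  - by move: ft; have := h t; rewrite !inE => ->.
move=> y; case: (sW [pred y | `[< exists x, y = f x >]]) => [|h|h].
- split=> [|w wd].
    split=> [|a u v /asboolP[u' ->] /asboolP[v' ->]]; apply/asboolP.
      by exists 0; rewrite linear0.
    by exists (a *: u' + v'); rewrite linearP.
  move=> /asboolP[x xE] d; apply/asboolP; exists (gpr hT (d - c) x).
  by rewrite -fp -xE subrK (gpr_uniq hW wd erefl).
- move: ft; have := h (f t); rewrite !inE => <- /negP[].
  by apply/asboolP; exists t.
- by have := h y; rewrite !inE => /asboolP.
Qed.

(** Lying in a degree means being fixed by its projection, and an injective map reflects that
    equation. *)
Lemma graded_bij_degE (T W : lmodType A) (Td : Z2 N -> {pred T})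
    (Wd : Z2 N -> {pred W}) (f : {linear T -> W}) c :
  is_grading Td -> is_grading Wd ->
  (forall d t, t \in Td d -> f t \in Wd (d + c)) -> injective f ->
  forall d t, (f t \in Wd (d + c)) = (t \in Td d).
Proof.
move=> hT hW fd fI d t; apply/idP/idP => [/(gpr_id hW)|]; last exact: fd.
by rewrite (gpr_morph hT hW fd) => /fI <-; apply: gpr_mem.
Qed.

Lemma giso_sym_shift (T W : lmodType A) (Td : Z2 N -> {pred T})
    (Wd : Z2 N -> {pred W}) c : giso Td (shift Wd c) -> giso Wd (shift Td c).
Proof.
case=> f /linear_bij_inv[g fK gK] fd; exists g => [|d w]; first by exists f.
rewrite -[w in RHS]gK /shift -[d in RHS]addr0 -(Z2addrr c) addrA.
by rewrite [RHS](fd (d + c)).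
Qed.

Lemma giso_trans_shift (T W X : lmodType A) (Td : Z2 N -> {pred T})
    (Wd : Z2 N -> {pred W}) (Xd : Z2 N -> {pred X}) c d :
  giso Td (shift Wd c) -> giso Wd (shift Xd d) -> giso Td (shift Xd (c + d)).
Proof.
case=> f bf fd [g bg gd]; exists (g \o f) => [|e t]; first exact: bij_comp.
by rewrite -(fd e) /= -(gd (e + c)) /shift addrA.
Qed.

End GradedModules.

(** * The induced module *)

Definition add_of (V W : zmodType) (f : V -> W) (fA : additive f) :
  {additive V -> W} := HB.pack f (GRing.isAdditive.Build V W _ fA).

Section InducedModule.
Variables (R : realType) (gT : finGroupType) (N : nat) (p : z2hom gT N).
Variables (s : {additive Z2 N -> 'F_2}) (om : cocycle R p s).
Variables (gc : Z2 N -> gT) (gcP : forall c, p (gc c) = c).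
Implicit Types (g h k : gT) (x y : R[i]) (c d : Z2 N).

Local Notation A := (twalg om).
Local Notation A0 := (twalg0 om).
Local Notation incl := (twincl om).
Local Notation act := (@Defs.gact R gT N p s).
Local Notation u c := (twb om (gc c)).

Lemma z2degV g : p g^-1%g = p g.
Proof.
by rewrite -[RHS]Z2opp; apply/eqP; rewrite -addr_eq0 -z2degM mulVg z2deg1.
Qed.

Definition twbV g : A := twC om (om g^-1%g g)^-1 * twb om g^-1%g.

Lemma twbVK g : twbV g * twb om g = 1.
Proof.
by rewrite -mulrA twbM mulVg twb1 mulr1 -rmorphM mulVf ?rmorph1 ?cocycle_neq0.
Qed.

(** The scalar in [twbV] makes it a left inverse by construction; that the same element is a right
    inverse is the cocycle identity at g, g^-1, g. *)
Lemma twbKV g : twb om g * twbV g = 1.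
Proof.
rewrite /twbV mulrA twbC -mulrA twbM mulgV twb1 mulr1 -rmorphM fmorphV.
have := cocycleP om g g^-1%g g.
rewrite mulgV mulVg cocycle1g cocycleg1 !mulr1 => ->.
by rewrite mulVf ?rmorph1 // fmorph_eq0 cocycle_neq0.
Qed.

Lemma twb_deg g : twb om g \in twdeg om (p g).
Proof. by rewrite -[twb om g]mul1r -(rmorph1 (twC om)); apply: twdegZb. Qed.

Lemma u_deg c : u c \in twdeg om c.
Proof. by have := twb_deg (gc c); rewrite gcP. Qed.

(** The action of g on scalars depends only on the degree of g, so all of A_c moves a scalar in the
    way g_c does. *)
Lemma twdegC c (a : A) x :
  a \in twdeg om c -> a * twC om x = twC om (act (gc c) x) * a.
Proof.
move=> /twdegP ac; rewrite [a]twalgE mulr_sumr mulr_suml; apply: eq_bigr => g _.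
have [->|/ac pg] := eqVneq (a g) 0; first by rewrite rmorph0 !mul0r mulr0.
rewrite -mulrA twbC !mulrA -!rmorphM /= mulrC.
by congr (twC _ (_ * _) * _); rewrite /Defs.gact gcP pg.
Qed.

Lemma gact0 x : act (gc 0) x = x.
Proof. by rewrite /Defs.gact gcP raddf0 eqxx. Qed.

(** Since s(0) = 0. This is why A_0 acts on V by complex-linear maps. *)
Lemma twC0_central x (b : A0) : twC0 om x * b = b * twC0 om x.
Proof. by apply: val_inj; rewrite /= (twdegC _ (valP b)) gact0. Qed.

Definition twgr : is_grading (twdeg om) := let: And4 h _ _ _ := twalg_graded om in h.

Lemma gprMr c d (a h : A) : h \in twdeg om d ->
  gpr twgr (c + d) (a * h) = gpr twgr c a * h.
Proof.
move=> hd; have f_add : additive (fun a : A => a * h) by move=> ? ?; rewrite mulrBl.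
by apply: (gpr_morph twgr twgr (f := add_of f_add)) => e x xe; apply: twdegM.
Qed.

Lemma gprMl c d (a h : A) : h \in twdeg om d ->
  gpr twgr (c + d) (h * a) = h * gpr twgr c a.
Proof.
move=> hd; have f_add : additive (fun a : A => h * a) by move=> ? ?; rewrite mulrBr.
apply: (gpr_morph twgr twgr (f := add_of f_add)) => e x xe.
by rewrite addrC; apply: twdegM.
Qed.

(* cmp c a is the element of C[G_0, omega] for which the degree-c part of a is
   g_c . cmp c a. *)
Definition cmp c (a : A) : A0 :=
  exist _ (gpr twgr 0 (twbV (gc c) * a)) (gpr_mem _ _ _).

Lemma cmpE c a : u c * incl (cmp c a) = gpr twgr c a.
Proof. by rewrite /= -(gprMl _ _ (u_deg c)) add0r mulrA twbKV mul1r. Qed.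

Lemma cmp_sum a : a = \sum_c u c * incl (cmp c a).
Proof. by under eq_bigr do rewrite cmpE; rewrite -gpr_sum. Qed.

Fact cmp_additive c : additive (cmp c).
Proof. by move=> a b; apply: val_inj; rewrite /= mulrBr raddfB. Qed.

HB.instance Definition _ c := GRing.isAdditive.Build A A0 (cmp c) (cmp_additive c).

Lemma cmpM c a (b : A0) : cmp c (a * incl b) = cmp c a * b.
Proof.
apply: val_inj; rewrite /= mulrA.
by have := gprMr 0 (twbV (gc c) * a) (valP b); rewrite addr0.
Qed.

Lemma cmp_u c d (b : A0) : cmp c (u d * incl b) = if c == d then b else 0.
Proof.
have hd : u d * incl b \in twdeg om d.
  by have := twdegM (u_deg d) (valP b); rewrite addr0.
apply: val_inj; apply: (@twb_lreg _ _ _ _ _ om (gc c)); rewrite cmpE (gpr_hom _ _ hd).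
by case: eqP => [->//|_]; rewrite mulr0.
Qed.

Lemma dsum_sumE (B : pzRingType) (J : finType) (W : J -> lmodType B) (I : Type)
    (r : seq I) (P : pred I) (F : I -> dsum W) j :
  (\sum_(i <- r | P i) F i) j = \sum_(i <- r | P i) F i j.
Proof. by elim/big_rec2: _ => // i y1 y2 _ <-. Qed.

Section InducedModel.
Variable V : lmodType A0.

(** A name distinct from [dsum], which already carries an A_0-action. The proof argument puts [gcP]
    into the type, so that the A-module instance, whose axioms rest on it, can be inferred. *)
Definition indmod of (forall c, p (gc c) = c) : Type := dsum (fun _ : Z2 N => V).
Local Notation T := (indmod gcP).

HB.instance Definition _ := GRing.Zmodule.on T.

Definition indmod_scale (a : A) (w : T) : T :=
  fun c => \sum_c' cmp c (a * u c') *: w c'.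

Definition indmod_tens (a : A) (v : V) : T := fun c => cmp c a *: v.

(** A is a free right A_0-module on the g_c, and left multiplication by a has the matrix with
    entries [cmp c (a * u c')]. The formula is this matrix applied to the column of b;
    [indmod_scale] applies it to columns over V. *)
Lemma cmp_mul c a b : cmp c (a * b) = \sum_c' cmp c (a * u c') * cmp c' b.
Proof.
rewrite {1}(cmp_sum b) mulr_sumr raddf_sum; apply: eq_bigr => c' _.
by rewrite mulrA; apply: cmpM.
Qed.

Fact indmod_scaleA a b w : indmod_scale a (indmod_scale b w) = indmod_scale (a * b) w.
Proof.
apply: functional_extensionality_dep => c; rewrite /indmod_scale.
under eq_bigr => c' _ do rewrite scaler_sumr.
rewrite exchange_big; apply: eq_bigr => c'' _ /=.
rewrite -[a * b * _]mulrA cmp_mul scaler_suml.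
by apply: eq_bigr => c' _; rewrite scalerA.
Qed.

Fact indmod_scale1 : left_id 1 indmod_scale.
Proof.
move=> w; apply: functional_extensionality_dep => c; rewrite /indmod_scale.
rewrite (bigD1 c) //= big1 => [|c' cc'];
  rewrite mul1r -[u _]mulr1 -(rmorph1 incl) cmp_u; last first.
  by rewrite eq_sym (negPf cc') scale0r.
by rewrite eqxx scale1r addr0.
Qed.

Fact indmod_scaleDr : right_distributive indmod_scale +%R.
Proof.
move=> a v w; apply: functional_extensionality_dep => c.
rewrite [RHS](_ : _ = indmod_scale a v c + indmod_scale a w c) //.
by rewrite -big_split; apply: eq_bigr => c' _; apply: scalerDr.
Qed.

Fact indmod_scaleDl w : {morph indmod_scale^~ w : a b / a + b}.
Proof.
move=> a b; apply: functional_extensionality_dep => c.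
rewrite [RHS](_ : _ = indmod_scale a w c + indmod_scale b w c) //.
by rewrite -big_split; apply: eq_bigr => c' _; rewrite mulrDl raddfD; apply: scalerDl.
Qed.

HB.instance Definition _ := GRing.Zmodule_isLmodule.Build A T
  indmod_scaleA indmod_scale1 indmod_scaleDr indmod_scaleDl.

Lemma indmod_sum (w : T) : w = \sum_c indmod_tens (u c) (w c).
Proof.
apply: functional_extensionality_dep => c; rewrite dsum_sumE (bigD1 c) //= big1.
  by rewrite /indmod_tens -[u c]mulr1 -(rmorph1 incl) cmp_u eqxx scale1r addr0.
move=> c' cc'; rewrite /indmod_tens -[u c']mulr1 -(rmorph1 incl) cmp_u eq_sym.
by rewrite (negPf cc') scale0r.
Qed.

Lemma indmod_is_tensor : @is_tensor _ _ incl V T indmod_tens.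
Proof.
split.
- split=> [a v w|a b v|a b v]; apply: functional_extensionality_dep => c.
  + exact: scalerDr.
  + by rewrite /indmod_tens raddfD; apply: scalerDl.
  + by rewrite /indmod_tens cmpM scalerA.
- move=> a b v; apply: functional_extensionality_dep => c.
  by rewrite /indmod_tens cmp_mul scaler_suml; apply: eq_bigr => c' _; rewrite -scalerA.
move=> M phi [phiDr phiDl phib].
have f_add : additive (fun w : T => \sum_c phi (u c) (w c)).
  move=> v w; rewrite -sumrB; apply: eq_bigr => c _.
  by apply/eqP; rewrite eq_sym subr_eq -phiDr subrK.
have phi0 v : phi 0 v = 0 by apply: (addrI (phi 0 v)); rewrite -phiDl !addr0.
exists (add_of f_add) => [a v|f' f'E w].
  rewrite /= [in RHS](cmp_sum a).
  rewrite (big_morph (phi^~ v) (id1 := 0) (op1 := +%R)) //.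
  by apply: eq_bigr => c _; rewrite phib.
by rewrite {1}(indmod_sum w) raddf_sum; apply: eq_bigr => c _; rewrite f'E.
Qed.

Lemma tensor_exists : exists (T : lmodType A) (tau : A -> V -> T), is_tensor incl tau.
Proof. by exists T, indmod_tens; apply: indmod_is_tensor. Qed.

End InducedModel.

Section Tensor.
Variables (V : lmodType A0) (T : lmodType A) (tau : A -> V -> T).
Hypothesis hT : is_tensor incl tau.

Lemma tauDr a v w : tau a (v + w) = tau a v + tau a w.
Proof. by case: hT => -[]. Qed.
Lemma tauDl a b v : tau (a + b) v = tau a v + tau b v.
Proof. by case: hT => -[]. Qed.
Lemma tau_bal a b v : tau (a * incl b) v = tau a (b *: v).
Proof. by case: hT => -[]. Qed.
Lemma tauM a b v : tau (a * b) v = a *: tau b v.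
Proof. by case: hT. Qed.
Lemma tauE a v : tau a v = a *: tau 1 v.
Proof. by rewrite -tauM mulr1. Qed.
Lemma tau1_bal (b : A0) v : incl b *: tau 1 v = tau 1 (b *: v).
Proof. by rewrite -tauE -[incl b]mul1r tau_bal. Qed.

Fact tau_additive a : additive (tau a).
Proof. by move=> v w; apply/eqP; rewrite eq_sym subr_eq -tauDr subrK. Qed.
HB.instance Definition _ a := GRing.isAdditive.Build V T (tau a) (tau_additive a).

Definition tau1 : {linear V -> restr incl T}.
Proof.
refine (@lin_of _ V (restr incl T) (tau 1) _).
by move=> b v w; rewrite tauDr -tau1_bal.
Defined.

Lemma tau1E v : tau1 v = tau 1 v. Proof. by []. Qed.

Lemma tau_cmp a v : tau a v = \sum_c tau (u c) (cmp c a *: v).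
Proof.
rewrite {1}(cmp_sum a) (big_morph (tau^~ v) (id1 := 0) (op1 := +%R)).
- by apply: eq_bigr => c _; rewrite tau_bal.
- by move=> *; apply: tauDl.
- by rewrite tauE scale0r.
Qed.

(** Only the universal property is used: existence gives a coordinate map f, and [bsum] after f is
    the identity by the uniqueness clause. *)
Lemma bsum_coord : exists co : T -> Z2 N -> V,
  cancel (bsum tau gc) co /\ cancel co (bsum tau gc).
Proof.
pose phi a v : dsum (fun _ : Z2 N => V) := fun c => cmp c a *: v.
have [_ _ /(_ _ phi)[|f fE _]] := hT.
  split=> [a v w|a b v|a b v]; apply: functional_extensionality_dep => c.
  + exact: scalerDr.
  + by rewrite /phi raddfD; apply: scalerDl.
  + by rewrite /phi cmpM scalerA.
exists f; split=> [w|].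
  rewrite raddf_sum; apply: functional_extensionality_dep => c.
  under eq_bigr do rewrite fE.
  rewrite dsum_sumE (bigD1 c) //= big1.
    by rewrite /phi -[u c]mulr1 -(rmorph1 incl) cmp_u eqxx scale1r addr0.
  move=> c' cc'; rewrite /phi -[u c']mulr1 -(rmorph1 incl) cmp_u eq_sym.
  by rewrite (negPf cc') scale0r.
have [taub _ /(_ _ tau taub)[g _ gU]] := hT.
have b_add : additive (fun t => bsum tau gc (f t)).
  move=> t t'; rewrite -sumrB; apply: eq_bigr => c _.
  by rewrite -[RHS]raddfB; congr (tau _ _); rewrite raddfB.
move=> t; rewrite [RHS](gU (idfun : {additive T -> T}) (fun _ _ => erefl) t).
have bE a v : add_of b_add (tau a v) = tau a v by rewrite /= fE [RHS]tau_cmp.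
exact: gU _ bE t.
Qed.

Lemma tensor_sum t : exists w : Z2 N -> V, t = \sum_c tau (u c) (w c).
Proof. by have [co [_ coK]] := bsum_coord; exists (co t); rewrite -[LHS]coK. Qed.

Lemma tensor_inj (w w' : Z2 N -> V) :
  \sum_c tau (u c) (w c) = \sum_c tau (u c) (w' c) -> w =1 w'.
Proof.
have [co [wK _]] := bsum_coord.
by move=> /(congr1 co); rewrite (wK w) (wK w') => ->.
Qed.

Lemma tau_u_inj c : injective (tau (u c)).
Proof.
move=> v v' e; pose w (v : V) d := if d == c then v else 0.
have wE (x : V) : \sum_d tau (u d) (w x d) = tau (u c) x.
  rewrite (bigD1 c) //= /w eqxx big1 ?addr0 // => d /negPf ->.
  exact: raddf0.
have := @tensor_inj (w v) (w v') _ c; rewrite /w eqxx; apply.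
by rewrite !wE.
Qed.

Lemma tau1_inj : injective (tau 1).
Proof.
move=> v v' e; apply: (@tau_u_inj 0).
by rewrite tauE e -tauE.
Qed.

Lemma tau_deg c a v : a \in twdeg om c -> tau a v \in tdeg tau c.
Proof.
move=> ac; apply/asboolP; exists 1%N, (fun _ => a), (fun _ => v).
by rewrite big_ord1.
Qed.

Lemma tau1_deg v : tau 1 v \in tdeg tau 0.
Proof. exact/tau_deg/twdeg1. Qed.

(** Each a in A_c is g_c b with b in A_0, and b moves across the tensor sign; so a sum of several a
    (x) v collapses to a single term. *)
Lemma tdegP c t : reflect (exists v, t = tau (u c) v) (t \in tdeg tau c).
Proof.
apply: (iffP idP) => [/asboolP[n [a [v [ac ->]]]]|[v ->]]; last first.
  exact/tau_deg/u_deg.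
exists (\sum_j cmp c (a j) *: v j); rewrite raddf_sum; apply: eq_bigr => j _.
by rewrite /= -tau_bal cmpE gpr_id.
Qed.

Lemma tdegE c : tdeg tau c =i gtens tau (gc c).
Proof.
by move=> t; apply/idP/idP => [/tdegP h|/asboolP h]; [apply/asboolP | apply/tdegP].
Qed.

Lemma tdeg_grading : is_grading (tdeg tau).
Proof.
split=> [c|t].
  split=> [|x y /tdegP[v ->] /tdegP[w ->]]; apply/tdegP.
    by exists 0; rewrite raddf0.
  by exists (v - w); rewrite raddfB.
have [w ->] := tensor_sum t; exists [ffun c => tau (u c) (w c)]; split.
  split=> [c|]; first by rewrite ffunE; apply/tau_deg/u_deg.
  by under [RHS]eq_bigr do rewrite ffunE.
move=> w' [hw' e]; have {}hw' c : exists v, w' c = tau (u c) v by apply/tdegP; apply: hw'.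
have [w'' w''E] : exists w'', forall c, w' c = tau (u c) (w'' c).
  by exists (fun c => sval (cid (hw' c))) => c; case: cid.
apply/ffunP => c; rewrite ffunE w''E; congr (tau _ _); apply: tensor_inj.
by rewrite e; apply: eq_bigr => d _; rewrite w''E.
Qed.

Lemma tdeg_graded : graded_module (twdeg om) (tdeg tau).
Proof.
split=> [|c d a t ac]; first exact: tdeg_grading.
move=> /asboolP[n [b [v [bd ->]]]]; apply/asboolP.
exists n, (fun j => a * b j), v; split=> [j|]; first exact: twdegM.
by rewrite scaler_sumr; apply: eq_bigr => j _; rewrite tauM.
Qed.

Lemma tensor_linear_ext (M : lmodType A) (F G : {linear T -> M}) :
  (forall v, F (tau 1 v) = G (tau 1 v)) -> F =1 G.
Proof.
move=> FG t; have [w ->] := tensor_sum t; rewrite !linear_sum; apply: eq_bigr => c _.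
by rewrite tauE !linearZ FG.
Qed.

(** The existence half of Frobenius reciprocity; uniqueness is [tensor_linear_ext]. *)
Lemma tensor_extend (M : lmodType A) (f : {linear V -> restr incl M}) :
  exists F : {linear T -> M}, forall a v, F (tau a v) = a *: (f v : M).
Proof.
have [_ _ /(_ M (fun a v => a *: (f v : M)))[|F FE _]] := hT.
  split=> [a v w|a b v|a b v]; rewrite ?linearD ?scalerDr ?scalerDl //.
  by rewrite -scalerA linearZ.
have FL : linear F.
  move=> a t t'; rewrite raddfD; congr (_ + _); have [w ->] := tensor_sum t.
  rewrite !(scaler_sumr, raddf_sum); apply: eq_bigr => c _.
  by rewrite -tauM !FE scalerA.
by exists (lin_of FL) => a v; apply: FE.
Qed.

Lemma extend_deg (M : lmodType A) (Md : Z2 N -> {pred M}) (F : {linear T -> M}) c :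
  graded_module (twdeg om) Md -> (forall v, F (tau 1 v) \in Md c) ->
  forall d t, t \in tdeg tau d -> F t \in Md (d + c).
Proof.
move=> gM h d t /tdegP[v ->]; rewrite tauE linearZ.
by apply: gM.2; rewrite ?u_deg.
Qed.

(** The v with 1 (x) v in S form a submodule of V, and they determine S: it is stable under the unit
    g_c, which carries degree 0 onto degree c, and under its inverse. *)
Lemma tensor_simple : simple_module V -> simple_graded (twdeg om) (tdeg tau).
Proof.
move=> [[v v0] sV]; split; first exact: tdeg_graded.
  by exists (tau 1 v); rewrite -(raddf0 (tau 1)) (inj_eq tau1_inj).
move=> S gS; have [SS _] := gS; case: (sV [pred v | tau 1 v \in S]).
- split=> [|b x y]; rewrite !inE; first by rewrite raddf0; case: SS.
  by move=> hx hy; rewrite tauDr -tau1_bal; apply: SS.2.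
- move=> h; left=> t; rewrite inE; apply/idP/eqP => [tS|->]; last by case: SS.
  apply: (gpr_eq0 (hM := tdeg_grading)) => c.
  have := gsub_gpr tdeg_grading gS c tS.
  have /tdegP[w ->] := gpr_mem tdeg_grading c t => wS.
  have := h w; rewrite !inE.
  have -> : tau 1 w \in S by rewrite -(twbVK (gc c)) tauM; apply: submodZ.
  by move/esym/eqP => ->; rewrite raddf0.
- move=> h; right=> t; have [w ->] := tensor_sum t; rewrite [RHS]inE.
  apply: submod_sum => // c _; rewrite tauE; apply: submodZ => //.
  by have := h (w c); rewrite !inE.
Qed.

End Tensor.

(** Multiplication by g turns the action of g^-1 a g into that of a, because g (g^-1 a g) = a g;
    this is the reason for the twist in [conjmod]. *)
Lemma twconj_linear (W : lmodType A0) (M : lmodType A) (f : {linear W -> restr incl M}) g :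
  exists F : {linear conjmod W g -> restr incl M},
    forall w : W, F w = twb om g *: (f w : M).
Proof.
have FL : linear ((fun w : W => twb om g *: (f w : M))
    : conjmod W g -> restr incl M).
  move=> a v w /=; rewrite [LHS](_ : _ = twb om g *: f (twconj0 g a *: (v : W) + w)) //.
  rewrite linearD linearZ scalerDr; congr (_ + _).
  have e : twb om g * incl (twconj0 g a) = incl a * twb om g by apply: twconjE.
  change (twb om g *: (incl (twconj0 g a) *: (f v : M)) =
          incl a *: (twb om g *: (f v : M))).
  by rewrite !scalerA e.
by exists (lin_of FL).
Qed.

Section Item1.
Variables (V : lmodType A0) (T : lmodType A) (tau : A -> V -> T).
Hypothesis hT : is_tensor incl tau.

Lemma conj_linear g : exists F : {linear conjmod V g -> restr incl T},
    forall v : V, F v = tau (twb om g) v.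
Proof.
have [F FE] := twconj_linear (tau1 hT) g; exists F => v.
by rewrite FE tau1E -tauE.
Qed.

Lemma gtens_grading : is_grading (fun c => gtens tau (gc c)).
Proof.
have -> : (fun c => gtens tau (gc c)) = tdeg tau; last exact: tdeg_grading.
apply: functional_extensionality_dep => c.
by apply: functional_extensionality_dep => t; have := tdegE hT c t; rewrite !inE.
Qed.

Lemma gtens_submod c : submod_closed (gtens tau (gc c) : {pred restr incl T}).
Proof.
split=> [|a x y /asboolP[v ->] /asboolP[w ->]]; apply/asboolP.
  by exists 0; have /= -> := raddf0 (add_of (tau_additive hT (u c))).
have [F FE] := conj_linear (gc c).
by exists (a *: (v : conjmod V (gc c)) + w); rewrite -!FE linearP.
Qed.

End Item1.
End InducedModule.

Lemma F2_cases (a : 'F_2) : a = 0 \/ a = 1.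
Proof. by case: a => [[|[|]]] // ?; [left | right]; apply: val_inj. Qed.

(** If s is nontrivial on U, some c0 in U with s(c0) = 1 is put in front of a basis of the kernel K
    of s on U; every c - s(c) c0 lies in K. *)
Lemma adapted_exists N (s : {additive Z2 N -> 'F_2}) (U : {vspace Z2 N}) :
  exists r (z : r.-tuple (Z2 N)), adapted s U z.
Proof.
have [[c0 c0U sc0]|nU] := pselect (exists2 c, c \in U & s c != 0); last first.
  by exists (\dim U), (vbasis U); split=> //; apply: vbasisP.
have sZ (a : 'F_2) c : s (a *: c) = a * s c.
  by case: (F2_cases a) => ->; rewrite ?scale0r ?scale1r ?raddf0 ?mul0r ?mul1r.
have [|K KE] := @submod_vspace _ (Z2 N) [pred c | (c \in U) && (s c == 0)].
  split=> [|a x y]; first by rewrite inE mem0v raddf0 eqxx.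
  rewrite !inE => /andP[xU /eqP sx] /andP[yU /eqP sy].
  by rewrite raddfD sZ sx sy mulr0 addr0 eqxx memvD ?memvZ.
have sc1 : s c0 = 1 by case: (F2_cases (s c0)) sc0 => ->; rewrite ?eqxx.
exists (\dim K).+1, [tuple of c0 :: vbasis K]; split=> [|_ i].
  rewrite /basis_of free_cons (basis_free (vbasisP K)) andbT span_cons.
  rewrite (span_basis (vbasisP K)) KE inE (negPf sc0) andbF andbT.
  apply/eqP/vspaceP => c; apply/idP/idP => [/memv_addP[x /vlineP[a ->] [y yK ->]]|cU].
    by move: yK; rewrite KE inE => /andP[yU _]; rewrite memvD ?memvZ.
  rewrite -[c](subrK (s c *: c0)) addrC memv_add ?memvZ ?memv_line // KE inE.
  by rewrite memvB ?memvZ //= raddfB sZ sc1 mulr1 subrr.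
rewrite (tnth_nth 0) /=; case: i => [[|i] hi] //=.
have : (vbasis K)`_i \in K by apply: vbasis_mem; rewrite mem_nth // size_tuple.
by rewrite KE inE => /andP[_ /eqP ->].
Qed.

(** * Block matrices, and homomorphisms between induced modules *)

Section Homomorphisms.
Variables (R : realType) (gT : finGroupType) (N : nat) (p : z2hom gT N).
Variables (s : {additive Z2 N -> 'F_2}) (om : cocycle R p s).
Variables (gc : Z2 N -> gT) (gcP : forall c, p (gc c) = c).
Implicit Types (g h k : gT) (x y : R[i]) (c d : Z2 N).

Local Notation A := (twalg om).
Local Notation A0 := (twalg0 om).
Local Notation incl := (twincl om).
Local Notation act := (@Defs.gact R gT N p s).
Local Notation u c := (twb om (gc c)).

Lemma twC_u c x : twC om x * u c = u c * twC om (act (gc c) x).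
Proof. by rewrite twbC gactK. Qed.

(** The source of the factors nu in the block entries: by [nuP], nu is the scalar left over when g1
    g2 is written as g_c times an element of A_0. *)
Lemma twb_mul_u g1 g2 c : p g1 + p g2 = c ->
  twb om g1 * twb om g2 =
  u c * incl (twC0 om (nu om (gc c) g1 g2) * twb0 om ((gc c)^-1 * g1 * g2)%g).
Proof.
move=> pc; have inclM x (b : A0) : incl (twC0 om x * b) = twC om x * incl b.
  exact: rmorphM.
rewrite -(nuP om (gc c) g1 g2) inclM twb0E //.
by rewrite !z2degM z2degV gcP -addrA pc Z2addrr.
Qed.

(** Simplicity gives V = A_0 v, so the vectors g v span V over C. For g outside G_0 the default 0 of
    [twb0] is harmless, as elements of A_0 have coefficient 0 there. *)
Lemma simple_has_dim (V : lmodType A0) :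
  simple_module V -> exists n, has_dim (restr (twC0 om) V) n.
Proof.
case=> -[v v0] sV; case: (sV [pred w | `[< exists b : A0, w = b *: v >]]) => [|h|h].
- split=> [|a x y /asboolP[b ->] /asboolP[b' ->]]; apply/asboolP.
    by exists 0; rewrite scale0r.
  by exists (a * b + b'); rewrite scalerDl scalerA.
- have /asboolP[] : `[< exists b : A0, v = b *: v >] = false.
    by have := h v; rewrite !inE (negPf v0).
  by exists 1; rewrite scale1r.
apply: (@has_dim_span _ (restr (twC0 om) V) gT (fun g => twb0 om g *: v)) => w.
have := h w; rewrite !inE => /asboolP[b ->]; exists (val b).
rewrite [in LHS](_ : b = \sum_g twC0 om (val b g) * twb0 om g).
  by rewrite scaler_suml; apply: eq_bigr => g _; rewrite -scalerA.
apply: val_inj; rewrite [LHS](twalgE (val b)) [RHS]raddf_sum; apply: eq_bigr => g _.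
have [->|bg] := eqVneq (val b g) 0; first by rewrite !rmorph0 !mul0r.
have pg : p g = 0 by apply: (twdegP _ _ (valP b)).
by have := twb0E om pg => /= e; rewrite -e.
Qed.

Section Tensor.
Variables (V : lmodType A0) (T : lmodType A) (tau : A -> V -> T).
Hypothesis hT : is_tensor incl tau.

Lemma dsum_conj_iso : exists2 f : {linear dsum (fun c => conjmod V (gc c)) -> restr incl T},
  bijective f & forall w : Z2 N -> V, f w = bsum tau gc w.
Proof.
have bL : linear (bsum tau gc : dsum (fun c => conjmod V (gc c)) -> restr incl T).
  move=> a v w; rewrite /bsum scaler_sumr -big_split; apply: eq_bigr => c _ /=.
  by have [F FE] := conj_linear hT (gc c); rewrite -!FE -linearP.
exists (lin_of bL) => //.
by have [co [h1 h2]] := bsum_coord gcP hT; exists co.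
Qed.

(** A map of degree d has one nonzero block in each column, so it is enough to compute it on each
    g_c (x) V. *)
Lemma blocks_crit d (phi : T -> T) (M m : Z2 N -> Z2 N -> V -> V) : additive phi ->
  (forall c c' v, M c c' v = if c == c' + d then m c c' v else 0) ->
  (forall c v, phi (tau (u c) v) = tau (u (c + d)) (m (c + d) c v)) ->
  has_blocks tau gc phi M.
Proof.
move=> phiA ME phiE w; rewrite /bsum -[phi]/(add_of phiA : T -> T) raddf_sum /=.
rewrite [RHS](reindex_inj (addIr d)); apply: eq_bigr => c _ /=.
rewrite phiE /blockop (bigD1 c) //= ME eqxx big1 ?addr0 // => c' cc'.
by rewrite ME (inj_eq (addIr d)) eq_sym (negPf cc').
Qed.

Lemma scale_additive (B : pzRingType) (W : lmodType B) (a : B) :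
  additive (fun t : W => a *: t).
Proof. by move=> t t'; rewrite scalerBr. Qed.

Lemma rhoC_blocks x : has_blocks tau gc (fun t => twC om x *: t) (rhoC gc x).
Proof.
apply: (@blocks_crit 0 _ _ (fun c c' v => twC0 om (act (gc c) x) *: v)).
- exact: scale_additive.
- by move=> c c' v; rewrite addr0.
by move=> c v; rewrite addr0 -(tauM hT) twC_u -(tau_bal hT).
Qed.

Lemma rhoG_blocks g : has_blocks tau gc (fun t => twb om g *: t) (rhoG gc g).
Proof.
apply: (@blocks_crit (p g) _ _ (fun c c' v => twC0 om (nu om (gc c) g (gc c')) *:
      (twb0 om ((gc c)^-1 * g * gc c')%g *: v))) => //.
- exact: scale_additive.
move=> c v; rewrite -(tauM hT) (@twb_mul_u _ _ (c + p g)) ?gcP 1?addrC //.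
by rewrite (tau_bal hT) scalerA.
Qed.

Lemma theta_blocks z (phi : {linear T -> T}) (f : V -> V) :
  (forall c v, phi (tau (u c) v) = tau (u c * u z) (f v)) ->
  has_blocks tau gc phi (theta_block gc z f).
Proof.
move=> phiE; apply: (@blocks_crit z _ _ (fun c c' v =>
  twC0 om (nu om (gc c) (gc c') (gc z)) *:
      (twb0 om ((gc c)^-1 * gc c' * gc z)%g *: f v))) => //.
  exact: raddfB.
move=> c v; rewrite phiE (@twb_mul_u _ _ (c + z)) ?gcP //.
by rewrite (tau_bal hT) scalerA.
Qed.

Lemma tau_deg0 a v : forall ha : a \in twdeg om 0,
  tau a v = tau 1 ((exist _ a ha : A0) *: v).
Proof. by move=> ha; rewrite -(tau_bal hT) mul1r. Qed.

Lemma tdeg0P t : reflect (exists v, t = tau 1 v) (t \in tdeg tau 0).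
Proof.
apply: (iffP (tdegP gcP hT 0 t)) => [[v ->]|[v ->]].
  by rewrite (tau_deg0 v (u_deg om gcP 0)); eexists.
by apply/(tdegP gcP hT)/tau1_deg.
Qed.

Lemma conj_linear_inj g : exists2 F : {linear conjmod V g -> restr incl T},
  injective F & forall v : V, F v = tau (twb om g) v.
Proof.
have [F FE] := conj_linear hT g; exists F => // v w; rewrite !FE => e.
apply: (tau1_inj gcP hT); rewrite -(twbVK om g) !(tauM hT).
by rewrite e.
Qed.

Section Hom.
Variables (V' : lmodType A0) (T' : lmodType A) (tau' : A -> V' -> T').
Hypothesis hT' : is_tensor incl tau'.

(** The map a (x) v -> a g_c (x) f v is well defined because f is linear into the twisted module.
    For V' = V these maps are the theta of the theorem. *)
Lemma conj_hom c (f : {linear V -> conjmod V' (gc c)}) :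
  exists phi : {linear T -> T'},
    forall a v, phi (tau a v) = tau' (a * u c) (f v).
Proof.
have [F FE] := conj_linear hT' (gc c).
have [phi phiE] := tensor_extend gcP hT (F \o f); exists phi => a v.
by rewrite phiE (tauM hT') -FE.
Qed.

End Hom.
End Tensor.

(** Frobenius reciprocity followed by Schur's lemma: the extension of f to the induced module is
    nonzero and of degree c, hence bijective. *)
Lemma extend_giso (V : lmodType A0) (T : lmodType A) (tau : A -> V -> T)
    (hT : is_tensor incl tau) (M : lmodType A) (Md : Z2 N -> {pred M})
    (f : {linear V -> restr incl M}) c :
  simple_module V -> simple_graded (twdeg om) Md ->
  (forall v, (f v : M) \in Md c) -> (exists v, f v != 0) ->
  giso (tdeg tau) (shift Md c).
Proof.
move=> sV sM fd [v fv]; have [phi phiE] := tensor_extend gcP hT f.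
have [gM _ _] := sM; have sT := tensor_simple gcP hT sV.
have phid d t : t \in tdeg tau d -> phi t \in Md (d + c).
  by apply: (extend_deg gcP hT gM) => w; rewrite phiE scale1r; apply: fd.
have bphi : bijective phi.
  by apply: (simple_graded_bij sT sM phid); exists (tau 1 v); rewrite phiE scale1r.
exists phi => // d t; rewrite /shift.
exact: (graded_bij_degE (tdeg_grading gcP hT) gM.1 phid (bij_inj bphi)).
Qed.

Section HomConj.
Variables (V V' : lmodType A0) (T T' : lmodType A).
Variables (tau : A -> V -> T) (tau' : A -> V' -> T').
Hypotheses (hT : is_tensor incl tau) (hT' : is_tensor incl tau').

(** Converse of [conj_hom]: the degree-c part of the target is a copy of V'^(g_c), through which the
    restriction to 1 (x) V factors. *)
Lemma hom_conj c (phi : {linear T -> T'}) :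
  (forall v, phi (tau 1 v) \in tdeg tau' c) ->
  exists f : {linear V -> conjmod V' (gc c)},
    forall v, phi (tau 1 v) = tau' (u c) (f v).
Proof.
move=> h; have {}h v : exists w, phi (tau 1 v) = tau' (u c) w.
  by apply/(tdegP gcP hT'); apply: h.
pose f v : conjmod V' (gc c) := sval (cid (h v)).
have fE v : phi (tau 1 v) = tau' (u c) (f v) by rewrite /f; case: cid.
have [F FI FE] := conj_linear_inj hT' (gc c).
have fL : linear f.
  move=> a v w; apply: FI; rewrite linearP !FE -!fE.
  by rewrite (tauDr hT) -(tau1_bal hT) linearP.
by exists (lin_of fL).
Qed.

Lemma giso_conj c : giso (tdeg tau) (shift (tdeg tau') c) ->
  lmod_iso V (conjmod V' (gc c)).
Proof.
case=> phi bphi phid; have pinj := bij_inj bphi.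
have [|f fE] := @hom_conj c phi.
  by move=> v; have := phid 0 (tau 1 v); rewrite /shift add0r tau1_deg.
exists f; apply: bijective_surj => [v w e|w].
  by apply: (tau1_inj gcP hT); apply: pinj; rewrite !fE e.
case: bphi => psi _ psiK.
have : psi (tau' (u c) w) \in tdeg tau 0.
  by rewrite -phid psiK /shift add0r tau_deg // u_deg.
case/(tdeg0P hT) => v vE; exists v; apply: (tau_u_inj gcP hT' (c := c)).
by rewrite -fE -vE psiK.
Qed.

Lemma conj_giso c : simple_module V -> simple_module V' ->
  lmod_iso V (conjmod V' (gc c)) -> giso (tdeg tau) (shift (tdeg tau') c).
Proof.
move=> sV sV' [f bf]; have [F FI FE] := conj_linear_inj hT' (gc c).
apply: (extend_giso hT sV (tensor_simple gcP hT' sV') (f := F \o f)) => [v|].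
  by rewrite /= FE tau_deg // u_deg.
have [[v v0] _] := sV; exists v.
by rewrite -(linear0 (F \o f)) (inj_eq (inj_comp FI (bij_inj bf))).
Qed.

End HomConj.
End Homomorphisms.

(** * The graded endomorphism algebra *)

Lemma gend_sumE (K : comNzRingType) (A : algType K) (T : lmodType A) (I : Type)
    (r : seq I) (P : pred I) (F : I -> gend T) t :
  (\sum_(i <- r | P i) F i : gend T) t = \sum_(i <- r | P i) F i t.
Proof. by elim/big_rec2: _ => // i y1 y2 _ <-. Qed.

Section EndomorphismAlgebra.
Variables (R : realType) (gT : finGroupType) (N : nat) (p : z2hom gT N).
Variables (s : {additive Z2 N -> 'F_2}) (om : cocycle R p s).
Variables (gc : Z2 N -> gT) (gcP : forall c, p (gc c) = c).
Implicit Types (g h k : gT) (x y : R[i]) (c d : Z2 N).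

Local Notation A := (twalg om).
Local Notation A0 := (twalg0 om).
Local Notation incl := (twincl om).
Local Notation act := (@Defs.gact R gT N p s).
Local Notation u c := (twb om (gc c)).

Variables (V : lmodType A0) (T : lmodType A) (tau : A -> V -> T).
Hypothesis hT : is_tensor incl tau.
Local Notation D := (gend T).
Local Notation Dd := (end_deg (tdeg tau)).
Implicit Types (phi psi theta : D).

Lemma gend_eq phi psi : (forall v, phi (tau 1 v) = psi (tau 1 v)) -> phi = psi.
Proof. by move=> h; apply: gendP => t; apply: (tensor_linear_ext gcP hT h). Qed.

Lemma end_degP c phi :
  reflect (forall v, phi (tau 1 v) \in tdeg tau c) (phi \in Dd c).
Proof.
apply: (iffP idP) => [/asboolP h v|h].
  by rewrite -[c]add0r; apply: h; apply: tau1_deg.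
apply/asboolP; apply: (extend_deg gcP hT (tdeg_graded gcP hT)).
exact: h.
Qed.

Local Notation gp := (gpr (tdeg_grading gcP hT)).

Fact end_pr_linear c phi : linear ((fun v => gp c (phi (tau 1 v))) : V -> restr incl T).
Proof.
move=> b v w; rewrite (tauDr hT) -(tau1_bal hT) linearP raddfD.
congr (_ + _); have := gpr_scale (tdeg_grading gcP hT) (tdeg_graded gcP hT) c (phi (tau 1 v)) (valP b).
by rewrite addr0 => e; apply: e.
Qed.

(** Composing phi with a projection is in general not A-linear, so the component is prescribed on 1
    (x) V only and then extended. *)
Lemma end_pr_exists c phi :
  exists psi : D, forall v, psi (tau 1 v) = gp c (phi (tau 1 v)).
Proof.
have [F FE] := tensor_extend gcP hT (lin_of (end_pr_linear c phi)).
by exists F => v; apply: etrans (FE 1 v) _; rewrite scale1r.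
Qed.

Definition end_pr c phi : D := sval (cid (end_pr_exists c phi)).

Lemma end_prE c phi v : end_pr c phi (tau 1 v) = gp c (phi (tau 1 v)).
Proof. by rewrite /end_pr; case: cid. Qed.

Lemma end_grading : is_grading Dd.
Proof.
split=> [c|phi].
  split=> [|phi psi /end_degP hphi /end_degP hpsi]; apply/end_degP => v.
    exact: (gmem0 (tdeg_grading gcP hT)).
  exact: (gmemB (tdeg_grading gcP hT)).
exists [ffun c => end_pr c phi]; split; first split=> [c|].
- by rewrite ffunE; apply/end_degP => v; rewrite end_prE; apply: gpr_mem.
- apply: gend_eq => v; rewrite gend_sumE [LHS](gpr_sum (tdeg_grading gcP hT)).
  by apply: eq_bigr => c _; rewrite ffunE end_prE.
move=> w [hw phiE]; apply/ffunP => c; rewrite ffunE; apply: gend_eq => v.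
rewrite end_prE; apply: (@gpr_uniq _ _ _ _ _ (fun c => w c (tau 1 v))) => [d|].
  by apply/end_degP.
by rewrite phiE gend_sumE.
Qed.

Lemma end_degM c d phi psi : phi \in Dd c -> psi \in Dd d -> phi * psi \in Dd (c + d).
Proof.
move=> /asboolP hphi /asboolP hpsi; apply/asboolP => e t te.
by rewrite [c + d]addrC addrA; apply/hphi/hpsi.
Qed.

Lemma end_deg1 : 1 \in Dd 0.
Proof. by apply/end_degP => v; apply: tau1_deg. Qed.

Lemma end_graded : graded_algebra (fun (x : R) (phi : D) => x *: phi) Dd.
Proof.
split; [exact: end_grading | exact: end_deg1 | exact: end_degM |].
move=> c x phi /end_degP h; apply/end_degP => v.
have := (tdeg_graded gcP hT).2 0 c x%:A _ _ (h v); rewrite add0r; apply.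
by have [_ h1 _ hZ] := twalg_graded om; apply: hZ.
Qed.

Fact end_scalar_linear x : linear ((fun v => tau 1 (twC0 om x *: v)) : V -> restr incl T).
Proof.
move=> b v w; rewrite scalerDr (tauDr hT) scalerA (twC0_central gcP) -scalerA.
by rewrite -(tau1_bal hT).
Qed.

(** The scalar acts on the factor V, where it commutes with A_0; acting from the left of A (x) V it
    would not commute with an antilinear g. *)
Lemma end_scalar_exists x :
  exists psi : D, forall a v, psi (tau a v) = tau a (twC0 om x *: v).
Proof.
have [F FE] := tensor_extend gcP hT (lin_of (end_scalar_linear x)).
by exists F => a v; rewrite [RHS](tauE hT); apply: FE.
Qed.

Definition end_scalar x : D := sval (cid (end_scalar_exists x)).

Lemma end_scalarE x a v : end_scalar x (tau a v) = tau a (twC0 om x *: v).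
Proof. by rewrite /end_scalar; case: cid. Qed.

Fact end_scalar_additive : additive end_scalar.
Proof.
move=> x y; apply: gend_eq => v; rewrite [RHS](_ : _ = end_scalar x (tau 1 v) - end_scalar y (tau 1 v)) //.
by rewrite !end_scalarE rmorphB scalerBl (tau_additive hT).
Qed.

Fact end_scalar_multiplicative : multiplicative end_scalar.
Proof.
split=> [x y|]; apply: gend_eq => v.
  rewrite [RHS](_ : _ = end_scalar x (end_scalar y (tau 1 v))) //.
  by rewrite !end_scalarE rmorphM scalerA.
by rewrite end_scalarE rmorph1 scale1r.
Qed.

HB.instance Definition _ := GRing.isAdditive.Build R[i] D end_scalar end_scalar_additive.
HB.instance Definition _ := GRing.isMultiplicative.Build R[i] D end_scalar end_scalar_multiplicative.

Lemma end_scalar_deg x : end_scalar x \in Dd 0.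
Proof. by apply/end_degP => v; rewrite end_scalarE tau1_deg. Qed.

Lemma end_scalarR (x : R) : end_scalar (x%:C)%C = x *: (1 : D).
Proof.
apply: gend_eq => v; rewrite end_scalarE -(tau1_bal hT).
by congr (_ *: _); rewrite [RHS]mulr1.
Qed.

Lemma end_scalar_blocks x : has_blocks tau gc (end_scalar x) (diagC x).
Proof.
apply: (blocks_crit (d := 0) (m := fun c c' v => twC0 om x *: v)) => //.
- exact: raddfB.
- by move=> c c' v; rewrite addr0.
by move=> c v; rewrite end_scalarE addr0.
Qed.

(** phi sends 1 (x) v to some g_c (x) w, and moving x past g_c conjugates it when s(c) = 1. *)
Lemma end_scalarC c phi x : phi \in Dd c -> phi * end_scalar x = end_scalar (act (gc c) x) * phi.
Proof.
move=> /end_degP hphi; apply: gend_eq => v.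
rewrite [LHS](_ : _ = phi (end_scalar x (tau 1 v))) // end_scalarE -(tau1_bal hT) linearZ.
rewrite [RHS](_ : _ = end_scalar (act (gc c) x) (phi (tau 1 v))) //.
have /(tdegP gcP hT)[w ->] := hphi v.
rewrite end_scalarE [LHS](_ : _ = tau (twC om x * u c) w); last by rewrite (tauM hT).
by rewrite twC_u -(tau_bal hT).
Qed.

Hypothesis sV : simple_module V.

Let sT := tensor_simple gcP hT sV.

Lemma gend_neq0 : (1 : D) != 0.
Proof.
have [_ [t t0] _] := sT; apply: contraNneq t0 => e.
by rewrite -[t]/((1 : D) t) e.
Qed.

Lemma end_scalar_inj : injective end_scalar.
Proof.
apply: injective_of_kernel => x x0; apply/eqP; apply: contraNT gend_neq0 => xn.
by rewrite -(rmorph1 end_scalar) -(mulVf xn) rmorphM /= x0 mulr0.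
Qed.

Lemma end_deg_bij c phi : phi \in Dd c -> phi != 0 -> bijective phi.
Proof.
move=> /asboolP hphi phi0; apply: (simple_graded_bij (c := c) sT sT) => //.
apply: contrapT => h; case/negP: phi0; apply/eqP/gendP => t.
by apply/eqP; apply: contrapT => /negP ft; apply: h; exists t.
Qed.

Lemma end_division : graded_division Dd.
Proof.
move=> c phi hphi phi0; have /linear_bij_inv[psi phiK psiK] := end_deg_bij hphi phi0.
by exists (psi : D); split; apply: gendP => t; [apply: psiK | apply: phiK].
Qed.

(** The inverse has degree -c, which is c. *)
Lemma end_inv c phi : phi \in Dd c -> phi != 0 ->
  exists2 psi, psi \in Dd c & phi * psi = 1 /\ psi * phi = 1.
Proof.
move=> hphi phi0; have [psi [e1 e2]] := end_division hphi phi0.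
exists psi => //; apply/asboolP => d t td; have := hphi => /asboolP hphi'.
have pinj := bij_inj (end_deg_bij hphi phi0).
rewrite -(graded_bij_degE (tdeg_grading gcP hT) (tdeg_grading gcP hT) hphi' pinj).
rewrite -[phi (psi t)]/((phi * psi) t) e1.
by rewrite -addrA Z2addrr addr0.
Qed.

Lemma endM_neq0 c d phi psi : phi \in Dd c -> psi \in Dd d -> phi != 0 -> psi != 0 ->
  phi * psi != 0.
Proof.
move=> hphi _ phi0; apply: contra => /eqP e.
have [phi' _ [_ e1]] := end_inv hphi phi0.
by rewrite -[psi]mul1r -e1 -mulrA e mulr0.
Qed.

(** phi restricts to a complex-linear A_0-endomorphism f of V, which has an eigenvalue x. Its
    eigenspace is an A_0-submodule because x is central in A_0, hence it is all of V. *)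
Lemma end0P phi : phi \in Dd 0 <-> exists x, phi = end_scalar x.
Proof.
split=> [/end_degP h|[x ->]]; last exact: end_scalar_deg.
have {}h v : exists w, phi (tau 1 v) = tau 1 w by apply/(tdeg0P gcP hT); apply: h.
pose f v : V := sval (cid (h v)).
have fE v : phi (tau 1 v) = tau 1 (f v) by rewrite /f; case: cid.
have t1I := tau1_inj gcP hT.
have fL : linear f.
  move=> b v w; apply: t1I; rewrite (tauDr hT) -(tau1_bal hT) -!fE.
  by rewrite (tauDr hT) -(tau1_bal hT) linearP.
have fLC : linear (f : restr (twC0 om) V -> restr (twC0 om) V).
  by move=> x v w; apply: (fL (twC0 om x)).
have [n dimV] := simple_has_dim sV; have [nzV sV'] := sV.
have [x [v [v0 fv]]] := eigenvector_exists (lin_of fLC) dimV nzV.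
exists x; apply: gend_eq => w; rewrite fE end_scalarE; congr (tau _ _).
case: (sV' [pred w | f w == twC0 om x *: w]) => [|h'|h'].
- split=> [|b v' w']; rewrite !inE.
    by rewrite -[f]/(lin_of fL : V -> V) linear0 scaler0.
  by rewrite fL => /eqP -> /eqP ->; rewrite scalerDr !scalerA (twC0_central gcP).
- by have := h' v; rewrite !inE (negPf v0) => /negP[]; apply/eqP.
- by have := h' w; rewrite !inE => /eqP.
Qed.

Lemma stabP c : (exists2 phi, phi \in Dd c & phi != 0) <-> c \in stab gc V.
Proof.
split=> [[phi hphi phi0]|].
  rewrite inE; apply/asboolP/lmod_iso_sym/(giso_conj gcP hT hT (c := c)).
  have bphi := end_deg_bij hphi phi0; exists phi => // d t; rewrite /shift.
  have /asboolP h := hphi.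
  exact: (graded_bij_degE (tdeg_grading gcP hT) (tdeg_grading gcP hT) h (bij_inj bphi)).
rewrite inE => /asboolP/lmod_iso_sym/(conj_giso gcP hT hT sV sV)[phi bphi phid].
exists (phi : D); first by apply/asboolP => d t; rewrite -phid.
have [_ [t t0] _] := sT; apply: contraNneq t0 => phi0.
by rewrite -(inj_eq (bij_inj bphi)) linear0 -[phi t]/((phi : D) t) phi0.
Qed.

(** Products of nonzero homogeneous endomorphisms are nonzero; this replaces a comparison of
    iterated twists of V with V^(g_(c+d)). *)
Lemma stab_submod : submod_closed (stab gc V : {pred Z2 N}).
Proof.
split=> [|a c d /stabP[phi hphi phi0] /stabP[psi hpsi psi0]].
  by apply/stabP; exists 1; rewrite ?end_deg1 ?gend_neq0.
case: (F2_cases a) => ->; rewrite ?scale0r ?scale1r ?add0r; apply/stabP.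
  by exists psi.
by exists (phi * psi); [apply: end_degM | apply: endM_neq0 hphi hpsi _ _].
Qed.

Lemma end_deg_scalar c phi psi : phi \in Dd c -> psi \in Dd c -> psi != 0 ->
  exists x, phi = end_scalar x * psi.
Proof.
move=> hphi hpsi psi0; have [psi' hpsi' [e1 e2]] := end_inv hpsi psi0.
have /end0P[x xE] : phi * psi' \in Dd 0 by rewrite -(Z2addrr c); apply: end_degM.
by exists x; rewrite -xE -mulrA e2 mulr1.
Qed.

Lemma end_sqr c phi : phi \in Dd c -> phi != 0 ->
  exists2 x, x != 0 & phi ^+ 2 = end_scalar x.
Proof.
move=> hphi phi0; have /end0P[x xE] : phi * phi \in Dd 0.
  by rewrite -(Z2addrr c); apply: end_degM.
exists x => //; have := endM_neq0 hphi hphi phi0 phi0; rewrite xE.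
by apply: contraNneq => ->; rewrite rmorph0.
Qed.

Lemma end_antilinear c phi x : s c = 1 -> phi \in Dd c -> phi * end_scalar x = end_scalar x^* * phi.
Proof.
by move=> sc /end_scalarC ->; rewrite /Defs.gact gcP sc oner_eq0.
Qed.

Lemma end_linear c phi x : s c = 0 -> phi \in Dd c -> phi * end_scalar x = end_scalar x * phi.
Proof. by move=> sc /end_scalarC ->; rewrite /Defs.gact gcP sc eqxx. Qed.

(** A factor y multiplies phi^2 = x by y^2, since phi is complex-linear, and y can be an inverse
    square root of x. *)
Lemma end_linear_normalize c phi : s c = 0 -> phi \in Dd c -> phi != 0 ->
  exists2 x, x != 0 & (end_scalar x * phi) ^+ 2 = 1.
Proof.
move=> sc hphi phi0; have [x x0 xE] := end_sqr hphi phi0.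
exists (sqrtC x)^-1; first by rewrite invr_eq0 sqrtC_eq0.
rewrite expr2 mulrA -(mulrA (end_scalar _)) (end_linear _ sc hphi) mulrA -rmorphM /=.
rewrite -mulrA -[phi * phi]/(phi ^+ 2) xE -rmorphM /= -expr2 exprVn sqrtCK mulVf //.
exact: rmorph1.
Qed.

(** phi commutes with phi^2 = x but conjugates scalars, so x is real. A factor y multiplies phi^2 by
    y y^*, which is positive: |x| can be removed and the sign stays. *)
Lemma end_antilinear_normalize c phi : s c = 1 -> phi \in Dd c -> phi != 0 ->
  exists2 x, x != 0 & (end_scalar x * phi) ^+ 2 = 1 \/ (end_scalar x * phi) ^+ 2 = -1.
Proof.
move=> sc hphi phi0; have [x x0 xE] := end_sqr hphi phi0.
have xR : x \is Num.real.
  apply/CrealP; apply: end_scalar_inj; have [psi _ [e1 e2]] := end_inv hphi phi0.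
  rewrite -[LHS]mulr1 -e1 mulrA -(end_antilinear _ sc hphi) -xE.
  by rewrite expr2 -!mulrA e1 mulr1.
have nx0 : `|x| != 0 by rewrite normr_eq0.
pose y := (sqrtC `|x|)^-1; have y0 : y != 0 by rewrite invr_eq0 sqrtC_eq0.
have yR : y^* = y.
  by apply/CrealP; rewrite rpredV ger0_real // sqrtC_ge0.
have E : (end_scalar y * phi) ^+ 2 = end_scalar (`|x|^-1 * x).
  rewrite expr2 mulrA -(mulrA (end_scalar _)) (end_antilinear _ sc hphi) yR.
  rewrite mulrA -rmorphM /= -mulrA -[phi * phi]/(phi ^+ 2) xE -rmorphM /= -expr2 exprVn.
  by rewrite sqrtCK.
exists y => //; rewrite E; case/real_ge0P: xR => [_|_].
  by left; rewrite mulVf // rmorph1.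
by right; rewrite invrN mulNr mulVf // rmorphN rmorph1.
Qed.

(** phi psi = x psi phi because D_(c+d) is a line over D_0. Conjugating psi twice by phi, with phi^2
    = 1 and phi complex-linear, gives x^2 = 1; so the two commute or anticommute. psi may be
    antilinear. *)
Lemma end_sign c d phi psi : s c = 0 -> phi \in Dd c -> psi \in Dd d ->
  phi ^+ 2 = 1 -> psi ^+ 2 = 1 \/ psi ^+ 2 = -1 ->
  ((phi * psi) ^+ 2 = 1 \/ (phi * psi) ^+ 2 = -1) /\
  ((psi * phi) ^+ 2 = 1 \/ (psi * phi) ^+ 2 = -1).
Proof.
move=> sc hphi hpsi phi2 psi2.
have phi0 : phi != 0 by apply: contraNneq gend_neq0 => e; rewrite -phi2 e expr0n.
have psi0 : psi != 0.
  apply: contraNneq gend_neq0 => e.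
  by case: psi2; rewrite e expr0n /= => /eqP; rewrite eq_sym ?oppr_eq0.
have [x xE] : exists x, phi * psi = end_scalar x * (psi * phi).
  apply: (@end_deg_scalar (c + d)); [exact: end_degM | | exact: endM_neq0 hpsi hphi _ _].
  by rewrite addrC; apply: end_degM.
have : end_scalar (x ^+ 2) * psi = psi.
  rewrite -[RHS]mul1r -phi2 expr2 -[RHS]mulrA xE mulrA (end_linear _ sc hphi).
  rewrite -(mulrA (end_scalar x)) [phi * (psi * phi)]mulrA xE -!mulrA.
  by rewrite -[phi * phi]/(phi ^+ 2) phi2 mulr1 mulrA -rmorphM.
have [psi' _ [e1 e2]] := end_inv hpsi psi0.
move/(congr1 ( *%R^~ psi')); rewrite -mulrA e1 mulr1 => ixE.
have x1 : (x == 1) || (x == -1).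
  by rewrite -sqrf_eq1; apply/eqP/end_scalar_inj; rewrite ixE rmorph1.
have xsq : phi * psi = psi * phi \/ phi * psi = - (psi * phi).
  case/orP: x1 => /eqP x1; rewrite xE x1; [left | right].
    by rewrite rmorph1 mul1r.
  by rewrite rmorphN rmorph1 mulN1r.
have pp : psi * phi * (phi * psi) = psi ^+ 2.
  by rewrite mulrA -(mulrA psi) -[phi * phi]/(phi ^+ 2) phi2 mulr1.
have pp' : phi * psi * (psi * phi) = psi ^+ 2.
  rewrite mulrA -(mulrA phi) -[psi * psi]/(psi ^+ 2).
  by case: psi2 => ->; rewrite ?mulr1 ?mulrN1 ?mulNr -[phi * phi]/(phi ^+ 2) phi2.
have sg (a b : D) : a = b \/ a = - b -> a * b = psi ^+ 2 ->
    a ^+ 2 = 1 \/ a ^+ 2 = -1.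
  move=> ab e; have [->//|->] : a ^+ 2 = psi ^+ 2 \/ a ^+ 2 = - psi ^+ 2.
    rewrite expr2; case: ab => ab; [left | right]; rewrite {2}ab ?mulrN e //.
  by case: psi2 => ->; rewrite ?opprK; [right | left].
split; first exact: sg _ _ xsq pp'.
by apply: sg _ _ _ pp; case: xsq => ->; rewrite ?opprK; [left | right].
Qed.

Section Theta.
Variables (z : Z2 N) (f : {linear V -> conjmod V (gc z)}).
Hypothesis bf : bijective f.

Lemma theta_exists : exists theta,
  [/\ forall a v, theta (tau a v) = tau (a * u z) (f v),
      has_blocks tau gc theta (theta_block gc z f), theta \in Dd z & theta != 0].
Proof.
have [theta thetaE] := conj_hom gcP hT hT f; exists (theta : D); split.
- exact: thetaE.
- by apply: (theta_blocks gcP hT) => c v; apply: thetaE.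
- by apply/end_degP => v; rewrite [X in X \in _]thetaE mul1r; apply/tau_deg/u_deg.
have [[v v0] _] := sV; apply: contraNneq v0 => e.
rewrite -(inj_eq (bij_inj bf)) linear0; apply/eqP/(tau_u_inj gcP hT (c := z)).
have /= -> := raddf0 (add_of (tau_additive hT (u z))).
by rewrite -[u z]mul1r -thetaE -[theta _]/((theta : D) _) e.
Qed.

(** Composing theta with a scalar amounts to scaling f, so a normalised theta again has blocks of
    the prescribed form. *)
Lemma theta_scale_blocks theta x : (forall a v, theta (tau a v) = tau (a * u z) (f v)) ->
  has_blocks tau gc (end_scalar x * theta)
    (theta_block gc z (fun v => twC0 om x *: (f v : V))).
Proof.
move=> thetaE; apply: (theta_blocks gcP hT (phi := gend_val (end_scalar x * theta))) => c v.
by rewrite [LHS](_ : _ = end_scalar x (theta (tau (u c) v))) // thetaE end_scalarE.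
Qed.

End Theta.

Lemma end_generated r (z : r.-tuple (Z2 N)) (U : {vspace Z2 N}) (theta : 'I_r -> D) :
  U =i stab gc V -> basis_of U z ->
  (forall i, theta i \in Dd (tnth z i) /\ theta i != 0) ->
  generates (fun phi => phi \in Dd 0 \/ exists i, phi = theta i).
Proof.
move=> UE zB htheta S SR SX; have [S1 SB SM] := SR.
have S0 : 0 \in S by rewrite -(subrr 1) SB.
have SN (a : D) : a \in S -> - a \in S by move=> ?; rewrite -sub0r SB.
have SA (a b : D) : a \in S -> b \in S -> a + b \in S.
  by move=> ? ?; rewrite -[b]opprK SB // SN.
(* [P c] says that S meets D_c outside 0. It is closed under addition of degrees, as homogeneous
   elements have nonzero products, and so passes from the basis z to all of U. *)
pose P c := exists psi, [/\ psi \in S, psi \in Dd c & psi != 0].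
have P0 : P 0 by exists 1; rewrite S1 end_deg1 gend_neq0.
have PD c d : P c -> P d -> P (c + d).
  move=> [psi1 [h1 h2 h3]] [psi2 [k1 k2 k3]]; exists (psi1 * psi2).
  by split; [exact: SM | exact: end_degM | exact: endM_neq0 h2 k2 _ _].
have PU c : c \in U -> P c.
  move=> cU; rewrite (coord_basis zB cU).
  elim/big_rec: _ => [|i d _ Pd]; first exact: P0.
  apply: PD Pd.
  case: (F2_cases (coord z i c)) => ->; first by rewrite scale0r; apply: P0.
  have [h1 h2] := htheta i; rewrite scale1r; exists (theta i).
  by split; [apply: SX; right; exists i | rewrite -tnth_nth |].
move=> phi; rewrite [RHS]inE [phi](gpr_sum end_grading).
apply: (big_ind (fun phi => phi \in S)) => // c _.
have [->//|nz] := eqVneq (gpr end_grading c phi) 0.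
have hc := gpr_mem end_grading c phi.
have /PU[psi [h1 h2 h3]] : c \in U by rewrite UE; apply/stabP; exists (gpr end_grading c phi).
have [x ->] := end_deg_scalar hc h2 h3.
by apply: SM => //; apply: SX; left; apply: end_scalar_deg.
Qed.

End EndomorphismAlgebra.

(** * Semisimplicity and density *)

Section SubGraded.
Variables (N : nat) (A : pzRingType) (Ad : Z2 N -> {pred A}).
Variables (M : lmodType A) (Md : Z2 N -> {pred M}) (gM : graded_module Ad Md).
Variable S : submod M.
Hypothesis gS : graded_submodule Md S.

Definition subdeg c : {pred subT S} := [pred x : subT S | \val x \in Md c].

Lemma subT_graded : graded_module Ad subdeg.
Proof.
have hM := gM.1; split=> [|c d a t ac td]; last exact: gM.2.
split=> [c|x]; first split=> [|x y xc yc].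
- exact: (gmem0 hM).
- by rewrite inE raddfB; apply: (gmemB hM).
have wS c : gpr hM c (\val x) \in S by apply: (gsub_gpr hM gS); apply: valP.
exists [ffun c => exist _ (gpr hM c (\val x)) (wS c) : subT S]; split; first split.
- by move=> c; rewrite ffunE; apply: (gpr_mem hM c (\val x)).
- apply: val_inj; rewrite raddf_sum [LHS](gpr_sum hM).
  by apply: eq_bigr => c _; rewrite ffunE.
move=> w [hw xE]; apply/ffunP => c; rewrite ffunE; apply: val_inj => /=.
apply: (@gpr_uniq _ _ _ _ _ (fun c => \val (w c))) => [d|]; first exact: hw.
by rewrite xE; apply: (raddf_sum (subT_incl S)).
Qed.

End SubGraded.

Section Semisimplicity.
Variables (R : realType) (gT : finGroupType) (N : nat) (p : z2hom gT N).
Variables (s : {additive Z2 N -> 'F_2}) (om : cocycle R p s).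
Variables (gc : Z2 N -> gT) (gcP : forall c, p (gc c) = c).
Implicit Types (g h k : gT) (x y : R[i]) (c d : Z2 N).

Local Notation A := (twalg om).
Local Notation A0 := (twalg0 om).
Local Notation incl := (twincl om).
Local Notation act := (@Defs.gact R gT N p s).
Local Notation u c := (twb om (gc c)).
Local Notation Ar := (A^o : lmodType A).
Local Notation Ad := (twdeg om : Z2 N -> {pred Ar}).
Local Notation vA := ({ffun gT -> R[i]^o} : vectType R[i]).

Lemma regular_graded : graded_module (twdeg om) Ad.
Proof. by split=> [|c d a t ac td]; [exact: twgr | exact: twdegM]. Qed.

(** Left multiplication by [twC om x] is pointwise scaling by x, so left ideals are complex
    subspaces and have a dimension. *)
Lemma ideal_vspace (S : {pred Ar}) : submod_closed S ->
  exists U : {vspace vA}, forall a : A, (a \in U) = (a \in S).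
Proof.
move=> SS; have [|U UE] := @submod_vspace _ vA S; last by exists U => a; apply: UE.
split=> [|x a b]; first by case: SS.
have -> : x *: a + b = (twC om x * a : A) + b.
  by apply/ffunP => g; rewrite ffunE [RHS]ffunE twCM_coef ffunE.
by case: SS => _; apply.
Qed.

(** For the averaging argument: conjugation by k cancels its antilinearity, so each k^-1 pi k is
    complex-linear. *)
Lemma twbV_C k x : twbV om k * twC om (act k x) = twC om x * twbV om k.
Proof.
apply: (@twb_lreg _ _ _ _ _ om k).
by rewrite mulrA twbKV mul1r [RHS]mulrA twbC -mulrA twbKV mulr1.
Qed.

(** The change of variable k -> k h in the average over the group, with its cocycle factor. *)
Lemma twbV_om k h : twbV om k * twC om (om k h) = twb om h * twbV om (k * h)%g.
Proof.
apply: (@twb_lreg _ _ _ _ _ om k).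
by rewrite mulrA twbKV mul1r [RHS]mulrA twbM -mulrA twbKV mulr1.
Qed.

(* e is the average over g of g^-1 . pi g, with pi a C-linear projection of A
   onto S; its degree-0 part has the same property. *)
Lemma maschke (S : {pred Ar}) : graded_submodule Ad S ->
  exists e : A, [/\ e \in S, e \in twdeg om 0 & forall a : A, a \in S -> a * e = a].
Proof.
move=> gS; have [SS _] := gS; have [U UE] := ideal_vspace SS.
pose pi (a : A) : A := projv U a.
have piS a : pi a \in S by rewrite -UE; apply: (memv_proj U a).
have piC x a : pi (twC om x * a) = twC om x * pi a.
  have E b : twC om x * b = x *: (b : vA) by apply/ffunP => g; rewrite twCM_coef ffunE.
  by rewrite !E /pi linearZ.
have piD a b : pi (a + b) = pi a + pi b by apply: (linearD (projv U)).
pose F g := twbV om g * pi (twb om g).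
pose P (a : A) : A := \sum_k twbV om k * pi (twb om k * a).
have PD a b : P (a + b) = P a + P b.
  by rewrite -big_split; apply: eq_bigr => k _; rewrite mulrDr piD mulrDr.
have P1 : P 1 = \sum_g F g by apply: eq_bigr => k _; rewrite mulr1.
have PC x a : P (twC om x * a) = twC om x * P a.
  rewrite mulr_sumr; apply: eq_bigr => k _; rewrite mulrA twbC -mulrA piC.
  by rewrite mulrA twbV_C -[LHS]mulrA.
have Pb h : P (twb om h) = twb om h * P 1.
  rewrite P1 mulr_sumr [RHS](reindex_inj (mulIg h)) /=; apply: eq_bigr => k _.
  by rewrite twbM piC mulrA twbV_om -[LHS]mulrA.
have P0 : P 0 = 0 by apply: (addrI (P 0)); rewrite -PD !addr0.
(* P is left A-linear, hence right multiplication by [P 1]. *)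
have PE a : P a = a * P 1.
  rewrite [in LHS](twalgE a) [in RHS](twalgE a) mulr_suml.
  rewrite (big_morph P (id1 := 0) (op1 := +%R)) //.
  by apply: eq_bigr => g _; rewrite PC Pb mulrA.
have PS a : a \in S -> P a = a *+ #|gT|.
  move=> aS; rewrite -sumr_const; apply: eq_bigr => k _.
  rewrite /pi projv_id ?mulrA ?twbVK ?mul1r // UE.
  exact: (submodZ (twb om k) SS aS).
have n0 : (#|gT|%:R : R) != 0.
  by rewrite pnatr_eq0 -lt0n; apply/card_gt0P; exists 1%g.
pose e := (#|gT|%:R : R)^-1 *: P 1.
have eS : e \in S.
  rewrite /e -mulr_algl; apply: (submodZ _ SS).
  apply: (big_ind (fun a : A => a \in S)) => [|a b aS bS|k _]; first by case: SS.
    exact: (@submodD A Ar S a b SS aS bS).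
  exact: (submodZ _ SS (piS _)).
have eE a : a \in S -> a * e = a.
  move=> aS; rewrite -scalerAr -PE PS // -(@scaler_nat R A) scalerA mulVf //.
  exact: (@scale1r R A a).
have gprS c a : a \in S -> gpr (twgr om) c a \in S.
  exact: (gsub_gpr (twgr om : is_grading Ad) gS c).
exists (gpr (twgr om) 0 e); split; [exact: gprS | exact: gpr_mem |].
(* For homogeneous a, multiplying by the degree-0 part of e gives the component of a e = a in the
   degree of a. *)
move=> a aS; rewrite [a in LHS](gpr_sum (twgr om)) mulr_suml [RHS](gpr_sum (twgr om)).
apply: eq_bigr => c _; have hc := gpr_mem (twgr om) c a.
by rewrite -(gprMl 0 e hc) eE ?gprS // add0r gpr_id.
Qed.

Definition minideal (L : {pred Ar}) :=
  [/\ graded_submodule Ad L, exists2 a, a \in L & a != 0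
    & forall S, graded_submodule Ad S -> {subset S <= L} ->
        (exists2 a, a \in S & a != 0) -> {subset L <= S}].

(** A nonzero graded left ideal of least complex dimension inside S is minimal. *)
Lemma minideal_exists (S : {pred Ar}) : graded_submodule Ad S ->
  (exists2 a, a \in S & a != 0) -> exists L, minideal L /\ {subset L <= S}.
Proof.
move=> gS nS; pose Q n := `[< exists (L : {pred Ar}) (U : {vspace vA}),
  [/\ graded_submodule Ad L, (forall a : A, (a \in U) = (a \in L)),
      {subset L <= S}, (exists2 a, a \in L & a != 0) & \dim U = n] >].
have : exists n, Q n.
  have [U UE] := ideal_vspace gS.1; exists (\dim U); apply/asboolP.
  by exists S, U; split.
case/ex_minnP => n /asboolP[L [U [gL UE LS nL <-]]] nmin.
exists L; split=> //; split=> // S' gS' S'L nS' a aL.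
have [U' U'E] := ideal_vspace gS'.1.
have U'U : (U' <= U)%VS by apply/subvP => b; rewrite U'E UE; apply: S'L.
have /eqP UU : U' == U.
  rewrite eqEdim U'U; apply: nmin; apply/asboolP; exists S', U'; split=> //.
  by move=> b /S'L /LS.
by rewrite -U'E UU UE.
Qed.

(** A graded submodule of the type [subT L] is pushed forward to a graded left ideal S' of A inside
    L; [insub] keeps S' within L. *)
Lemma minideal_simple (L : submod Ar) : minideal L ->
  simple_graded (twdeg om) (subdeg Ad (S := L)).
Proof.
case=> gL [a aL a0] Lmin; have gT' := subT_graded regular_graded gL.
split=> //; first by exists (exist _ a aL).
move=> S [SS gS]; pose S' : {pred Ar} := [pred b | if insub b is Some b' then b' \in S else false].
have S'E (b : subT L) : (\val b \in S') = (b \in S) by rewrite inE valK.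
have S'L b : b \in S' -> b \in L by rewrite inE; case: insubP.
have lift b : b \in S' -> exists2 b', b' \in S & b = \val b'.
  by rewrite inE; case: insubP => // b' _ <- h; exists b'.
have gS' : graded_submodule Ad S'.
  split=> [|w wd].
    split=> [|x b b' /lift[v vS ->] /lift[v' v'S ->]].
      by rewrite -(raddf0 (\val : subT L -> _)) S'E; case: SS.
    by rewrite -(linearP (subT_incl L)) S'E; apply: SS.2.
  move=> hw c; have wL d : w d \in L by apply: gL.2 => //; apply: S'L.
  pose w' d : subT L := exist _ (w d) (wL d).
  rewrite -[w c]/(\val (w' c)) S'E; apply: gS => [d|]; first exact: wd.
  rewrite -S'E; move: hw; rewrite raddf_sum.
  by congr (_ \in _); apply: eq_bigr.
have [S0|[b [bS b0]]] : S =i pred1 0 \/ exists b, b \in S /\ b != 0.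
- have [h|h] := pselect (exists b, b \in S /\ b != 0); [by right | left=> b].
  apply/idP/eqP => [bS|->]; last by case: SS.
  by apply: contrapT => /eqP b0; apply: h; exists b.
- by left.
- right=> v; rewrite -S'E; apply/idP; apply: (Lmin S') => //; last exact: valP.
  exists (\val b); first by rewrite S'E.
  by rewrite -(raddf0 (\val : subT L -> _)) (inj_eq val_inj).
Qed.

(** The sum of the minimal graded left ideals, in inductive form: [socle 1] then allows
    faithfulness, density and finiteness to be proved by induction on how 1 is built up. *)
Inductive socle : A -> Prop :=
| socle0 : socle 0
| socleD a b : socle a -> socle b -> socle (a + b)
| socle_in (L : submod Ar) (a : A) : minideal L -> a \in submod_pred L -> socle a.

Lemma socle1 : socle 1.
Proof.
(* With e as in maschke for the socle S, if e <> 1 then {a | a e = 0} contains a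
   minimal ideal L; but L is contained in S, where a e = a. *)
pose S : {pred Ar} := [pred a : A | `[< socle a >]].
have SS : submod_closed S.
  split=> [|a b c /asboolP sb /asboolP sc]; first exact/asboolP/socle0.
  apply/asboolP/socleD => //; elim: sb => [|b1 b2 _ h1 _ h2|L b' hL b'L].
  - by rewrite scaler0; apply: socle0.
  - by rewrite scalerDr; apply: socleD.
  - by apply: (socle_in hL); apply: (submodZ _ (submodP L)).
have socle_gpr c a : socle a -> socle (gpr (twgr om) c a).
  elim=> [|b1 b2 _ h1 _ h2|L b hL bL].
  - by rewrite raddf0; apply: socle0.
  - by rewrite raddfD; apply: socleD.
  - apply: (socle_in hL); have [gL _ _] := hL.
    exact: (gsub_gpr (twgr om : is_grading Ad) gL c).
have gS : graded_submodule Ad S.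
  split=> // w wd /asboolP hw c; apply/asboolP.
  by rewrite -(gpr_uniq (twgr om) wd erefl c); apply: socle_gpr.
have [e [eS e0 eE]] := maschke gS.
have [/eqP|ne] := eqVneq (1 - e) 0.
  by rewrite subr_eq0 => /eqP ->; apply/asboolP.
pose S' : {pred Ar} := [pred a : A | a * e == 0].
have gS' : graded_submodule Ad S'.
  split=> [|w wd].
    split=> [|a b c /eqP hb /eqP hc]; rewrite inE ?mul0r //.
    by rewrite mulrDl -[a *: b]/(a * b : A) -mulrA hb hc mulr0 addr0.
  move=> /eqP hw c; rewrite inE -(gpr_uniq (twgr om) wd erefl c).
  by rewrite -(gprMr _ _ e0) hw raddf0.
have [|L [Lmin LS']] := minideal_exists gS'.
  by exists (1 - e) => //; rewrite inE mulrBl mul1r eE // subrr.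
have [[LL _] [a aL a0] _] := Lmin.
have aS : a \in S by apply/asboolP; apply: (@socle_in (Submod LL)).
by move: a0 (LS' _ aL); rewrite inE eE // => /negPf ->.
Qed.

Lemma degree_submod (M : lmodType A) (Md : Z2 N -> {pred M}) :
  graded_module (twdeg om) Md -> forall c, submod_closed (Md c : {pred restr incl M}).
Proof.
move=> gM c; split=> [|b m m' mc m'c]; first exact: (gmem0 gM.1).
apply: (gmemD gM.1) => //.
by have := gM.2 0 c _ _ (valP b) mc; rewrite add0r.
Qed.


End Semisimplicity.

(** * Classification of the simple graded modules, and the double centralizer *)

Section SimpleGraded.
Variables (R : realType) (gT : finGroupType) (N : nat) (p : z2hom gT N).
Variables (s : {additive Z2 N -> 'F_2}) (om : cocycle R p s).
Variables (gc : Z2 N -> gT) (gcP : forall c, p (gc c) = c).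
Implicit Types (g h k : gT) (x y : R[i]) (c d : Z2 N).

Local Notation A := (twalg om).
Local Notation A0 := (twalg0 om).
Local Notation incl := (twincl om).
Local Notation u c := (twb om (gc c)).
Local Notation Ar := (A^o : lmodType A).
Local Notation Ad := (twdeg om : Z2 N -> {pred Ar}).

Section DegreePart.
Variables (M : lmodType A) (Md : Z2 N -> {pred M}) (gM : graded_module (twdeg om) Md).

Local Notation hM := (gM.1).

Definition degpart c : lmodType A0 := subT (Submod (degree_submod gM c)).

Lemma degpart_linear c : exists f : {linear degpart c -> restr incl M},
  [/\ injective f, forall w, f w \in Md c
    & forall m, m \in Md c -> exists w, f w = m].
Proof.
exists (subT_incl (Submod (degree_submod gM c))); split=> [||m mc].
- exact: val_inj.
- by move=> w; apply: (valP w).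
by exists (exist _ m mc).
Qed.

Lemma gpr_scale_hom c d (a : A) m : m \in Md d ->
  gpr gM.1 c (a *: m) = gpr (twgr om) (c - d) a *: m.
Proof.
move=> md; apply: (@gpr_uniq _ _ _ _ _ (fun c => gpr (twgr om) (c - d) a *: m)) => [e|].
  by rewrite -[e in X in _ \in X](subrK d) gM.2 // gpr_mem.
rewrite {1}[a](gpr_sum (twgr om)) scaler_suml [RHS](reindex_inj (addIr d)) /=.
by apply: eq_bigr => e _; rewrite addrK.
Qed.

(** Q, the set of m with (A m)_c inside S, is the largest graded submodule whose degree-c part lies
    in S. It is 0 or M, and accordingly S is 0 or M_c. *)
Lemma degpart_simple c : simple_graded (twdeg om) Md ->
  (exists2 m, m \in Md c & m != 0) -> simple_module (degpart c).
Proof.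
move=> [_ _ sM] [m mc m0]; split; first by exists (exist _ m mc).
move=> S SS; pose Q : {pred M} := [pred m : M |
  `[< forall a : A, exists2 w : degpart c, w \in S & \val w = gpr hM c (a *: m) >]].
have scaleE (b : A0) (w : degpart c) : \val (b *: w) = incl b *: (\val w : M) by [].
have gQ : graded_submodule Md Q.
  split=> [|w wd].
    split=> [|b x y /asboolP hx /asboolP hy]; apply/asboolP => a.
      by exists 0; [case: SS | rewrite scaler0 !raddf0].
    have [w1 w1S e1] := hx (a * b); have [w2 w2S e2] := hy a.
    exists (w1 + w2); first exact: submodD SS w1S w2S.
    by rewrite raddfD /= e1 e2 scalerDr scalerA raddfD.
  move=> /asboolP hw d; apply/asboolP => a.
  have [w' w'S e] := hw (gpr (twgr om) (c - d) a); exists w' => //.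
  rewrite e (gpr_scale_hom _ _ (wd d)) -(gpr_uniq hM wd erefl d).
  have := gpr_scale hM gM d (\sum_c w c) (gpr_mem (twgr om) (c - d) a).
  by rewrite addrC subrK.
case: (sM Q gQ) => [h|h].
  left=> w; rewrite inE; apply/idP/eqP => [wS|->]; last by case: SS.
  apply: val_inj; have := h (\val w); rewrite !inE => hw.
  apply/eqP; rewrite -hw; apply/asboolP => a.
  exists ((exist _ (gpr (twgr om) 0 a) (gpr_mem _ _ _) : A0) *: w).
    exact: submodZ.
  by rewrite scaleE (gpr_scale_hom _ _ (valP w)) subrr.
right=> w; rewrite [RHS]inE; have := h (\val w); rewrite !inE => /asboolP/(_ 1).
by rewrite scale1r gpr_id ?(valP w) // => -[w' w'S /val_inj <-].
Qed.

End DegreePart.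

Section Classification.
Variables (I : finType) (V : I -> lmodType A0) (T : I -> lmodType A).
Variable tau : forall i, A -> V i -> T i.
Hypotheses (repsV : simple_reps gc V) (hT : forall i, is_tensor incl (@tau i)).

Let sV i : simple_module (V i). Proof. by case: repsV. Qed.

(** A nonzero M_c is a simple A_0-module W; some V i is isomorphic to W^(g_d), and multiplication by
    g_d embeds it in degree d + c. *)
Lemma simple_graded_classify (M : lmodType A) (Md : Z2 N -> {pred M}) :
  simple_graded (twdeg om) Md -> exists i c, giso Md (shift (tdeg (@tau i)) c).
Proof.
move=> sM; have [gM [m m0] _] := sM; have [c mc] := gpr_neq0 gM.1 m0.
have sW : simple_module (degpart gM c).
  by apply: degpart_simple => //; exists (gpr gM.1 c m); rewrite ?gpr_mem.
have [_ /(_ _ sW)[i [d [f bf]]] _] := repsV; exists i, (d + c).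
have [k [kI kd _]] := degpart_linear gM c.
have [F FE] := twconj_linear k (gc d).
apply: giso_sym_shift; apply: (extend_giso gcP (hT i) (sV i) sM (f := F \o f)).
  by move=> v; rewrite /= FE; apply: gM.2; [apply: u_deg | apply: kd].
have [[v v0] _] := sV i; exists v; rewrite /= FE; apply: contraNneq v0 => e.
rewrite -(inj_eq (bij_inj bf)) linear0; apply/eqP/kI; rewrite [RHS](linear0 k).
by rewrite -[LHS](scale1r (k (f v) : M)) -(twbVK om (gc d)) -scalerA e scaler0.
Qed.

Lemma giso_eq i j c : giso (tdeg (@tau i)) (shift (tdeg (@tau j)) c) -> i = j.
Proof. by move=> /(giso_conj gcP (hT i) (hT j)); case: repsV => _ _; apply. Qed.

(** phi need not be homogeneous: one nonzero component of its restriction to 1 (x) V already extends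
    to an isomorphism up to shift, which forces i = j. *)
Lemma hom_zero i j (phi : {linear T i -> T j}) : i != j -> forall t, phi t = 0.
Proof.
move=> ij; have zL : linear ((fun=> 0) : T i -> T j).
  by move=> a t t'; rewrite scaler0 addr0.
apply: (tensor_linear_ext gcP (hT i) (G := lin_of zL)) => v /=.
have hM := tdeg_grading gcP (hT j); have gM := tdeg_graded gcP (hT j).
apply: (gpr_eq0 (hM := hM)) => c; apply: contrapT => /eqP nz.
have fL : linear ((fun v => gpr hM c (phi (tau 1 v))) : V i -> restr incl (T j)).
  move=> b w w'; rewrite (tauDr (hT i)) -(tau1_bal (hT i)) linearP raddfD.
  congr (_ + _).
  have := gpr_scale hM gM c (phi (tau 1 w)) (valP b).
  by rewrite addr0 => e; apply: e.
case/eqP: ij; apply: (@giso_eq _ _ c).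
apply: (extend_giso gcP (hT i) (sV i) (tensor_simple gcP (hT j) (sV j)) (f := lin_of fL)).
  by move=> w; apply: gpr_mem.
by exists v.
Qed.

Lemma socle_iso (L : submod Ar) : minideal L ->
  exists i (f : {linear subT L -> T i}), bijective f.
Proof. by move/minideal_simple/simple_graded_classify => [i [c [f bf _]]]; exists i, f. Qed.

Lemma simple_graded_faithful (a : A) : (forall i (t : T i), a *: t = 0) -> a = 0.
Proof.
move=> ha; rewrite -[a]mulr1; elim: (socle1 om) => [|b1 b2 _ h1 _ h2|L b hL bL].
- by rewrite mulr0.
- by rewrite mulrDr h1 h2 addr0.
have [i [f bf]] := socle_iso hL; pose b' : subT L := exist _ b bL.
have : a *: b' = 0 by apply: (bij_inj bf); rewrite linearZ /= ha linear0.
by move/(congr1 (@subT_incl _ _ L)).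
Qed.

(* Jacobson density for the double centralizer of the T i.  For b in a minimal
   ideal L identified with T i by f, right multiplication by t corresponds to an
   A-linear map T i -> T j, which commutes with the beta's; hence f^-1 (beta (f b))
   acts as beta o b. *)
Lemma density (beta : forall i, T i -> T i) :
  (forall i t t', beta i (t + t') = beta i t + beta i t') ->
  (forall i (phi : gend (T i)) t, beta i (phi t) = phi (beta i t)) ->
  exists a : A, forall i t, a *: t = beta i t.
Proof.
move=> betaD betaC.
have beta0 i : beta i 0 = 0 by apply: (addrI (beta i 0)); rewrite -betaD !addr0.
suff [a aE] : exists a : A, forall i t, a *: t = beta i ((1 : A) *: t).
  by exists a => i t; rewrite aE scale1r.
elim: (socle1 om) => [|b1 b2 _ [a1 h1] _ [a2 h2]|L b hL bL].
- by exists 0 => i t; rewrite !scale0r beta0.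
- by exists (a1 + a2) => i t; rewrite !scalerDl h1 h2 betaD.
have [i [f bf]] := socle_iso hL; have [g fK gK] := linear_bij_inv bf.
pose b' : subT L := exist _ b bL; exists (\val (g (beta i (f b')))) => j t.
have phiL : linear (fun m : T i => (\val (g m) : A) *: t).
  move=> a m m'; rewrite linearP -[\val _]/(subT_incl L _) linearP.
  by rewrite [LHS]scalerDl; congr (_ + _); rewrite scalerA.
pose phi : {linear T i -> T j} := lin_of phiL.
rewrite -[LHS]/(phi (beta i (f b'))).
have -> : b *: t = phi (f b') by rewrite /= fK.
have [ij|ij] := eqVneq i j; last by rewrite !(hom_zero _ ij) beta0.
by case: _ / ij phi => phi; rewrite -[phi]/(gend_val phi) betaC.
Qed.

End Classification.

(** Write 1 as a sum of elements b of minimal graded left ideals L. For t nonzero of degree 0 in A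
    (x) W some b t is nonzero; then a -> a t is an isomorphism of L onto A (x) W, and W is the
    degree-0 part of L. *)
Lemma simple_finite : exists (I : finType) (M : I -> lmodType A0),
  forall W : lmodType A0, simple_module W -> exists i, lmod_iso W (M i).
Proof.
suff [I [M hM]] : exists (I : finType) (M : I -> lmodType A0),
    forall (W : lmodType A0) (T : lmodType A) (tau : A -> W -> T),
    simple_module W -> is_tensor incl tau ->
    (exists2 t, t \in tdeg tau 0 & (1 : A) *: t != 0) -> exists i, lmod_iso W (M i).
  exists I, M => W sW; have [T [tau hT]] := tensor_exists gcP W.
  apply: (hM W T tau) => //; have [[w w0] _] := sW; exists (tau 1 w).
    exact: tau1_deg.
  by rewrite scale1r -(raddf0 (add_of (tau_additive hT 1))) (inj_eq (tau1_inj gcP hT)).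
elim: (socle1 om) => [|b1 b2 _ [I1 [M1 h1]] _ [I2 [M2 h2]]|L b hL bL].
- exists void, (fun i : void => match i with end) => W T tau _ _ [w _].
  by rewrite scale0r eqxx.
- exists (I1 + I2)%type, (fun i => match i with inl i => M1 i | inr i => M2 i end).
  move=> W T tau sW hT [t t0 nz].
  have [e|nz1] := eqVneq (b1 *: t) 0.
    have {}nz : b2 *: t != 0.
      by apply: contraNneq nz => e2; rewrite scalerDl e e2 addr0.
    have [|i iE] := h2 W T tau sW hT; first by exists t.
    by exists (inr i).
  have [|i iE] := h1 W T tau sW hT; first by exists t.
  by exists (inl i).
have sL := minideal_simple hL; have [gL _ _] := sL.
exists unit, (fun=> degpart gL 0) => W T tau sW hT [t t0 bt]; exists tt.
have sT := tensor_simple gcP hT sW; have hT' := tdeg_grading gcP hT.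
have fL : linear (fun a : subT L => (\val a : A) *: t).
  move=> a m m'; rewrite -[\val _]/(subT_incl L _) linearP.
  by rewrite [LHS]scalerDl; congr (_ + _); rewrite -scalerA.
have fd d (a : subT L) : a \in subdeg Ad (S := L) d -> lin_of fL a \in tdeg tau (d + 0).
  by move=> ad; apply: (tdeg_graded gcP hT).2.
have bf : bijective (lin_of fL).
  by apply: (simple_graded_bij sL sT fd); exists (exist _ b bL).
have fdE := graded_bij_degE gL.1 hT' fd (bij_inj bf).
have [g fK gK] := linear_bij_inv bf.
have [k [kI kd kS]] := degpart_linear gL 0.
have gd v : exists m, k m = g (tau 1 v).
  apply: kS; rewrite -fdE gK addr0; exact: tau1_deg.
pose h v : degpart gL 0 := sval (cid (gd v)).
have hE v : k (h v) = g (tau 1 v) by rewrite /h; case: cid.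
have hL' : linear h.
  move=> a v v'; apply: kI; rewrite linearP !hE.
  by rewrite (tauDr hT) -(tau1_bal hT) linearP.
exists (lin_of hL'); apply: bijective_surj => [v v' e|m].
  apply: (tau1_inj gcP hT); apply: (can_inj gK).
  by rewrite -!hE; congr (k _).
have := kd m; rewrite -fdE addr0.
case/(tdeg0P gcP hT) => v vE; exists v; apply: kI.
by rewrite /= hE -vE; apply: esym; apply: fK.
Qed.

(** The relation is handled as isomorphism up to shift of the induced modules, where symmetry and
    transitivity are immediate. Representatives are found by [pick], whose result depends only on
    the class. *)
Lemma simple_reps_exists : exists (I : finType) (V : I -> lmodType A0), simple_reps gc V.
Proof.
have [I [M hM]] := simple_finite.
have T (W : lmodType A0) :
    {T : lmodType A & {tau : A -> W -> T | is_tensor incl tau}}.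
  by have /cid[T /cid[tau h]] := tensor_exists gcP W; exists T, tau.
pose tens W := sval (tagged (T W)).
have hT W : is_tensor incl (tens W) := svalP (tagged (T W)).
pose eqv (V W : lmodType A0) := exists c, lmod_iso V (conjmod W (gc c)).
pose eqg (V W : lmodType A0) :=
  exists c, giso (tdeg (tens V)) (shift (tdeg (tens W)) c).
have eqvP V W : simple_module V -> simple_module W -> eqv V W <-> eqg V W.
  move=> sV sW; split=> -[c h]; exists c.
    exact: (conj_giso gcP (hT V) (hT W) sV sW).
  exact: (giso_conj gcP (hT V) (hT W)).
have eqg_sym V W : eqg V W -> eqg W V.
  by case=> c /giso_sym_shift; exists c.
have eqg_trans V W X : eqg V W -> eqg W X -> eqg V X.
  by move=> [c h] [d k]; exists (c + d); apply: giso_trans_shift h k.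
pose sM i := `[< simple_module (M i) >].
pose r i j := sM j && `[< eqg (M i) (M j) >].
have r_refl i : sM i -> r i i.
  move=> si; rewrite /r si; apply/asboolP; exists 0.
  exists idfun; first by exists idfun.
  by move=> c t; rewrite /shift addr0.
have r_eq i j : eqg (M i) (M j) -> r i =1 r j.
  move=> eij k; rewrite /r; congr (_ && _); apply/asboolP/asboolP.
    by apply: eqg_trans; apply: eqg_sym.
  exact: eqg_trans.
pose canon i := odflt i [pick j | r i j].
have canonP i : sM i -> r i (canon i).
  by move=> si; rewrite /canon; case: pickP => //= /(_ i); rewrite r_refl.
have canon_eq i j : sM i -> eqg (M i) (M j) -> canon i = canon j.
  move=> si /r_eq e; rewrite /canon -(eq_pick e); case: pickP => //= /(_ i).
  by rewrite r_refl.
pose I' := {i : I | sM i && (canon i == i)}.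
have sI' (i : I') : simple_module (M (val i)) by case/andP: (valP i) => /asboolP.
exists I', (fun i => M (val i)); split=> [//|W sW|i j c h].
  have [i iW] := hM W sW; have si : sM i by apply/asboolP; apply: simple_iso iW sW.
  have /andP[sj /asboolP ij] := canonP i si.
  have cj : canon (canon i) = canon i by rewrite -(canon_eq _ _ si ij).
  have j0 : sM (canon i) && (canon (canon i) == canon i) by rewrite sj cj eqxx.
  have [sj' si'] : simple_module (M (canon i)) /\ simple_module (M i).
    by split; apply/asboolP.
  have [d k] := (eqvP _ _ sj' si').2 (eqg_sym _ _ ij).
  exists (exist _ (canon i) j0), d; apply: lmod_iso_trans k _.
  case/lmod_iso_sym: iW => f bf.
  have fL : linear (f : conjmod (M i) (gc d) -> conjmod W (gc d)).
    by move=> a v w; apply: (linearP f (twconj0 (gc d) a) v w).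
  by exists (lin_of fL).
apply: val_inj; have [/andP[si /eqP <-] /andP[sj /eqP <-]] := (valP i, valP j).
apply: canon_eq => //; apply/eqvP => //.
by exists c.
Qed.

End SimpleGraded.

(** * Matrices over the graded endomorphism algebra *)

(** [m k] is the rank of position k among the positions with the same entry, so that a position is
    encoded by its entry and its rank. *)
Lemma fiber_labelling (T : eqType) n d (X : pred T) (t : n.-tuple T) :
  (forall c, count_mem c t = (X c * d)%N) ->
  exists m : 'I_n -> 'I_d,
    [/\ forall k, X (tnth t k),
        forall k l, tnth t k = tnth t l -> m k = m l -> k = l
      & forall c j, X c -> exists2 k, tnth t k = c & m k = j].
Proof.
move=> tX; pose fib c := [seq k <- enum 'I_n | tnth t k == c].
have fibE c : size (fib c) = (X c * d)%N.
  rewrite -tX size_filter -[in RHS](map_tnth_enum t) count_map.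
  by apply: eq_count.
have kfib k : k \in fib (tnth t k) by rewrite mem_filter eqxx mem_enum.
have mlt k : (index k (fib (tnth t k)) < X (tnth t k) * d)%N.
  by rewrite -fibE index_mem.
have Xk k : X (tnth t k) by case: (X _) (mlt k).
have {}mlt k : (index k (fib (tnth t k)) < d)%N by have := mlt k; rewrite Xk mul1n.
exists (fun k => Ordinal (mlt k)); split=> // [k l kl /(congr1 val) /= e|c j Xc].
  rewrite -[LHS](nth_index k (kfib k)) e kl nth_index //.
have : (j < size (fib c))%N by rewrite fibE Xc mul1n.
case E : (fib c) => [//|k0 r]; rewrite -E => jlt; pose k := nth k0 (fib c) j.
have : k \in fib c by rewrite mem_nth.
rewrite mem_filter => /andP[/eqP kc _]; exists k => //.
apply: val_inj; rewrite /= kc index_uniq //.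
by rewrite filter_uniq // enum_uniq.
Qed.

Lemma coset_transversal N (E X : {set Z2 N}) :
  submod_closed (E : {pred Z2 N}) -> is_transversal X (cosets E) [set: Z2 N] ->
  (forall c, exists2 x, x \in X & c - x \in E) /\
  (forall x y, x \in X -> y \in X -> x - y \in E -> x = y).
Proof.
move=> EE /and3P[_ _ /forall_inP trX].
have eqE : {in [set: Z2 N] & &, equivalence_rel (fun c c' : Z2 N => c' - c \in E)}.
  move=> x y z _ _ _ /=; split=> [|xy]; first by rewrite subrr; case: EE.
  apply/idP/idP => h.
    have -> : z - y = (z - x) - (y - x) by rewrite opprB addrA subrK.
    exact: submodB EE h xy.
  have -> : z - x = (z - y) + (y - x) by rewrite addrA subrK.
  exact: submodD EE h xy.
have blockE x y : (y \in pblock (cosets E) x) = (y - x \in E).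
  by rewrite (pblock_equivalence_partition eqE) ?inE.
have blockX x : #|X :&: pblock (cosets E) x| == 1%N.
  apply/trX/pblock_mem.
  by rewrite (cover_partition (equivalence_partitionP eqE)) inE.
have opE x y : (x - y \in E) = (y - x \in E).
  by rewrite -[x - y]opprB Z2opp.
split=> [c|x y xX yX xy].
  have /cards1P[x xE] := blockX c; have : x \in [set x] by rewrite inE.
  by rewrite -xE inE blockE opE => /andP[xX cx]; exists x.
have /cards1P[z zE] := blockX x.
have : x \in [set z] by rewrite -zE inE xX blockE subrr; case: EE.
have : y \in [set z] by rewrite -zE inE yX blockE opE.
by rewrite !inE => /eqP -> /eqP ->.
Qed.

Section Coordinates.
Variables (K : comNzRingType) (A : algType K) (T : lmodType A) (n : nat).
Variable b : 'I_n -> T.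
Local Notation D := (gend T).
Hypothesis bP : forall t, exists! phi : {ffun 'I_n -> D}, t = \sum_k phi k (b k).

Definition dcoord t : {ffun 'I_n -> D} := sval (cid (bP t)).

Lemma dcoordE t : t = \sum_k dcoord t k (b k).
Proof. by rewrite /dcoord; case: cid => phi /= []. Qed.

Lemma dcoord_uniq t (phi : 'I_n -> D) : t = \sum_k phi k (b k) -> forall k, dcoord t k = phi k.
Proof.
move=> tE k; rewrite /dcoord; case: cid => phi' /= [_ /(_ (finfun phi))->].
  by rewrite ffunE.
by under eq_bigr do rewrite ffunE.
Qed.

Lemma dcoordD t t' k : dcoord (t + t') k = dcoord t k + dcoord t' k.
Proof.
apply: (@dcoord_uniq _ (fun k => dcoord t k + dcoord t' k)).
by rewrite {1}[t]dcoordE {1}[t']dcoordE -big_split.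
Qed.

Lemma dcoordM (phi : D) t k : dcoord (phi t) k = phi * dcoord t k.
Proof.
apply: (@dcoord_uniq _ (fun k => phi * dcoord t k)).
by rewrite {1}[t]dcoordE linear_sum.
Qed.

Lemma dcoord_basis j k : dcoord (b j) k = (k == j)%:R.
Proof.
apply: (@dcoord_uniq _ (fun k => (k == j)%:R)).
rewrite (bigD1 j) //= eqxx big1 ?addr0 // => i /negPf ->.
by rewrite mulr0n.
Qed.

Lemma dcoord_basis_sum (F : 'I_n -> T) j : \sum_k dcoord (b j) k (F k) = F j.
Proof.
rewrite (bigD1 j) //= dcoord_basis eqxx [X in _ + X]big1 ?addr0 // => k /negPf kj.
by rewrite dcoord_basis kj.
Qed.

(** For a K-basis e of D, the vectors [e j (b k)] are a K-basis of T. *)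
Lemma has_dim_gend_basis m : has_dim D m -> has_dim (restr (GRing.in_alg A) T) (n * m).
Proof.
case=> e eP; have gsum (I : finType) (F : I -> D) t : (\sum_i F i : D) t = \sum_i F i t.
  exact: gend_sumE.
have sumE (x : {ffun 'I_n * 'I_m -> K}) :
    \sum_i (x i : K) *: (e i.2 (b i.1) : restr (GRing.in_alg A) T) =
    \sum_k (\sum_j x (k, j) *: e j : D) (b k) :> T.
  pose F k j := (x (k, j) : K) *: (e j (b k) : restr (GRing.in_alg A) T).
  transitivity (\sum_i F i.1 i.2); first by apply: eq_bigr => -[].
  rewrite -(pair_bigA _ F).
  by apply: eq_bigr => k _; rewrite gsum.
rewrite -[n]card_ord -[m in (_ * m)%N]card_ord -card_prod.
apply: (@fbasis_dim _ (restr (GRing.in_alg A) T) _ (fun i => e i.2 (b i.1))) => t.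
have [y yE] : exists y : 'I_n -> {ffun 'I_m -> K},
    forall k, dcoord t k = \sum_j y k j *: e j.
  by exists (fun k => sval (cid (eP (dcoord t k)))) => k; case: cid => y /= [].
exists [ffun i => y i.1 i.2]; split=> [|z].
  rewrite sumE [LHS]dcoordE; apply: eq_bigr => k _; rewrite yE; congr (gend_val _ _).
  by apply: eq_bigr => j _; rewrite ffunE.
rewrite sumE => /dcoord_uniq zE; apply/ffunP => -[k j]; rewrite ffunE /=.
have [w [_ wU]] := eP (dcoord t k).
rewrite -(wU (y k)) ?yE // (wU [ffun j => z (k, j)]) ?ffunE // zE.
by apply: eq_bigr => i _; rewrite ffunE.
Qed.

(** The entries lie in the converse ring because A commutes with D: in the expansion of a (a' b_j)
    the coefficients of a' stand to the left of those of a, opposite to a matrix product. *)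
Definition dmx (a : A) : 'M[D^c]_n := \matrix_(k, j) (dcoord (a *: b j) k : D^c).

Lemma dmxE a j : a *: b j = \sum_k (dmx a k j : D) (b k).
Proof. by rewrite [LHS]dcoordE; apply: eq_bigr => k _; rewrite mxE. Qed.

Lemma dmx_uniq a (B : 'M[D^c]_n) :
  (forall j, a *: b j = \sum_k (B k j : D) (b k)) -> dmx a = B.
Proof.
by move=> h; apply/matrixP => k j; rewrite mxE (dcoord_uniq (h j)).
Qed.

Fact dmx_additive : additive dmx.
Proof.
move=> a a'; apply: dmx_uniq => j; rewrite scalerBl !dmxE -sumrB.
by apply: eq_bigr => k _; rewrite !mxE.
Qed.

Fact dmx_multiplicative : multiplicative dmx.
Proof.
split=> [a a'|]; apply: dmx_uniq => j.
  rewrite -scalerA dmxE scaler_sumr.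
  transitivity (\sum_l \sum_k (dmx a' l j : D) ((dmx a k l : D) (b k))).
    apply: eq_bigr => l _; pose psi : D := dmx a' l j.
    have e : psi (a *: b l) = a *: psi (b l) by rewrite linearZ.
    by rewrite -[LHS]e dmxE linear_sum.
  rewrite exchange_big; apply: eq_bigr => k _; rewrite mxE.
  by rewrite -(gend_sumE _ _ (fun l => (dmx a' l j : D) * (dmx a k l : D))).
rewrite scale1r (bigD1 j) //= mxE eqxx big1 ?addr0 // => k kj.
by rewrite mxE (negPf kj).
Qed.

HB.instance Definition _ := GRing.isAdditive.Build A 'M[D^c]_n dmx dmx_additive.
HB.instance Definition _ := GRing.isMultiplicative.Build A 'M[D^c]_n dmx dmx_multiplicative.

Lemma dmxZ (x : K) a : dmx (x *: a) = map_mx (fun phi : D => x *: phi) (dmx a) :> 'M[D]_n.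
Proof.
apply: dmx_uniq => j; rewrite -mulr_algl -scalerA dmxE scaler_sumr.
by apply: eq_bigr => k _; rewrite [RHS](_ : _ = x%:A *: ((dmx a k j : D) (b k))) // mxE.
Qed.

End Coordinates.

(** * Homogeneous bases of induced modules over the graded division algebra *)

Section DivisionBasis.
Variables (R : realType) (gT : finGroupType) (N : nat) (p : z2hom gT N).
Variables (s : {additive Z2 N -> 'F_2}) (om : cocycle R p s).
Variables (gc : Z2 N -> gT) (gcP : forall c, p (gc c) = c).
Implicit Types (c d : Z2 N).

Local Notation A := (twalg om).
Local Notation A0 := (twalg0 om).
Local Notation incl := (twincl om).
Local Notation u c := (twb om (gc c)).

Variables (V : lmodType A0) (T : lmodType A) (tau : A -> V -> T).
Hypotheses (hT : is_tensor incl tau) (sV : simple_module V).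
Local Notation D := (gend T).
Local Notation Dd := (end_deg (tdeg tau)).
Local Notation E := (stab gc V).
Local Notation gD := (end_grading gcP hT).
Local Notation gTau := (tdeg_grading gcP hT).
Local Notation io := (end_scalar gcP hT).

Lemma gpr_end c d (phi : D) t : t \in tdeg tau d ->
  gpr gTau c (phi t) = gpr gD (c - d) phi t.
Proof.
move=> td; apply: (@gpr_uniq _ _ _ _ _ (fun c => gpr gD (c - d) phi t)) => [e|].
  have /asboolP/(_ _ _ td) := gpr_mem gD (e - d) phi.
  by rewrite subrKC.
rewrite {1}[phi](gpr_sum gD) gend_sumE [RHS](reindex_inj (addIr d)) /=.
by apply: eq_bigr => e _; rewrite addrK.
Qed.

Lemma end_not_stab c (phi : D) : phi \in Dd c -> c \notin E -> phi = 0.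
Proof.
by move=> hphi; apply: contraNeq => phi0; apply/(stabP gcP hT sV); exists phi.
Qed.

(** Each D_c is 0 or a complex line, so elements psi c and i psi c span D over the reals, with psi c
    = 0 off E. *)
Lemma gend_has_dim : exists2 m, (0 < m)%N & has_dim D m.
Proof.
have [psi psiP] : exists psi : Z2 N -> D, forall c phi, phi \in Dd c ->
    exists x, phi = io x * psi c.
  suff h c : exists psi : D, forall phi, phi \in Dd c -> exists x, phi = io x * psi.
    by exists (fun c => sval (cid (h c))) => c; case: cid.
  have [cE|cE] := boolP (c \in E).
    have /(stabP gcP hT sV)[psi hpsi psi0] := cE; exists psi => phi hphi.
    exact: (end_deg_scalar gcP hT sV hphi hpsi psi0).
  by exists 0 => phi /end_not_stab -> //; exists 0; rewrite mulr0.
have [|m hm] := @has_dim_span R D (Z2 N * bool)%type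
    (fun i => if i.2 then psi i.1 else io 'i%C * psi i.1).
  move=> phi; have [x xE] : exists x : Z2 N -> R[i],
      forall c, gpr gD c phi = io (x c) * psi c.
    exists (fun c => sval (cid (psiP c _ (gpr_mem gD c phi)))) => c.
    by case: cid.
  exists (fun i => if i.2 then complex.Re (x i.1) else complex.Im (x i.1)).
  rewrite [LHS](gpr_sum gD).
  pose F c (q : bool) := (if q then complex.Re (x c) else complex.Im (x c)) *:
    (if q then psi c else io 'i%C * psi c) : D.
  rewrite -[RHS](pair_bigA _ F); apply: eq_bigr => c _ /=.
  rewrite xE big_bool /F /=.
  have mulRl (r : R) (a : D) : r *: a = io (r%:C)%C * a.
    rewrite end_scalarR; apply: gendP => t; rewrite [RHS](_ : _ = r%:A *: (a t)) //.
  rewrite !mulRl [x c in LHS]complexE rmorphD rmorphM /= mulrDl.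
  by congr (_ + _); rewrite mulrA -!rmorphM /= mulrC.
exists m => //; case: m hm => // -[e /(_ 1)[x [e1 _]]].
by have := gend_neq0 gcP hT sV; rewrite e1 big_ord0 eqxx.
Qed.

Section Basis.
Variables (d0 : nat) (hd0 : has_dim (restr (twC0 om) V) d0).
Variables (X : {set Z2 N}) (cbar : (#|cosets E| * d0).-tuple (Z2 N)).
Hypothesis trX : is_transversal X (cosets E) [set: Z2 N].
Hypothesis cbarP : forall c, count_mem c cbar = ((c \in X) * d0)%N.
Local Notation n := (#|cosets E| * d0)%N.

Lemma division_basis : exists b : 'I_n -> T,
  (forall j, b j \in tdeg tau (tnth cbar j)) /\
  forall t, exists! phi : {ffun 'I_n -> D}, t = \sum_k phi k (b k).
Proof.
have [X1 X2] := coset_transversal (stab_submod gcP hT sV) trX.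
have [m [cX mI mS]] := fiber_labelling cbarP.
have [e eP] := hd0.
(* Position k encodes a representative of a coset of E together with a member of the complex basis e
   of V. *)
pose b k := tau (u (tnth cbar k)) (e (m k)).
have bd k : b k \in tdeg tau (tnth cbar k) by apply/tau_deg/u_deg.
exists b; split=> // t.
suff [phi phiE] : exists phi : {ffun 'I_n -> D}, t = \sum_k phi k (b k).
  (* A homogeneous component of a relation only involves the b k in one coset of
     E, hence of one degree, and becomes D_0-linear after multiplication by the
     inverse of an element of D_v. *)
  exists phi; split=> // phi' phi'E; apply/ffunP => l.
  apply/eqP; rewrite -subr_eq0; apply/eqP.
  pose psi k := phi k - phi' k.
  have psi0 : \sum_k psi k (b k) = 0.
    under eq_bigr => k _ do rewrite [psi k (b k)](_ : _ = phi k (b k) - phi' k (b k)) //.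
    by rewrite sumrB -phiE -phi'E subrr.
  rewrite -/(psi l); apply: (gpr_eq0 (hM := gD)) => v.
  have hv k := gpr_mem gD v (psi k).
  have [vE|] := boolP (v \in E); last exact: end_not_stab.
  have /(stabP gcP hT sV)[th hth th0] := vE.
  have [th' hth' [e1 e2]] := end_inv gcP hT sV hth th0.
  have io_k k : exists x, th' * gpr gD v (psi k) = io x.
    by apply/(end0P gcP hT sV); rewrite -(Z2addrr v) end_degM.
  have [x xE] : exists x : 'I_n -> R[i], forall k, th' * gpr gD v (psi k) = io (x k).
    by exists (fun k => sval (cid (io_k k))) => k; case: cid.
  suff xl : x l = 0.
    by rewrite -[LHS]mul1r -e1 -mulrA xE xl rmorph0 mulr0.
  have : \sum_(k | tnth cbar k == tnth cbar l) gpr gD v (psi k) (b k) = 0.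
    transitivity (gpr gTau (v + tnth cbar l) (\sum_k psi k (b k))); last first.
      by rewrite psi0 raddf0.
    rewrite raddf_sum big_mkcond; apply: eq_bigr => k _ /=.
    rewrite [RHS](gpr_end (v + tnth cbar l) (psi k) (bd k)).
    case: eqP => [->|/eqP ne]; first by rewrite addrK.
    suff -> : gpr gD (v + tnth cbar l - tnth cbar k) (psi k) = 0 by [].
    apply: (end_not_stab (gpr_mem gD _ _)); apply: contra ne => h; apply/eqP/esym/X2; rewrite ?cX //.
    have -> : tnth cbar l - tnth cbar k = v + tnth cbar l - tnth cbar k - v.
      by rewrite addrAC [v + _]addrC addrK.
    exact: submodB (stab_submod gcP hT sV) h vE.
  move/(congr1 th'); rewrite linear0 linear_sum.
  have E1 k : tnth cbar k == tnth cbar l ->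
      th' (gpr gD v (psi k) (b k)) = tau (u (tnth cbar l)) (twC0 om (x k) *: e (m k)).
    move/eqP => kl; rewrite -[LHS]/((th' * gpr gD v (psi k)) (b k)) xE.
    by rewrite end_scalarE kl.
  rewrite (eq_bigr _ E1).
  rewrite -(raddf_sum (add_of (tau_additive hT (u (tnth cbar l))))) /=.
  rewrite -[RHS](raddf0 (add_of (tau_additive hT (u (tnth cbar l))))) /=.
  move=> /(tau_u_inj gcP hT) sx0.
  pose y : {ffun 'I_d0 -> R[i]} :=
    [ffun j => \sum_(k | (tnth cbar k == tnth cbar l) && (m k == j)) x k].
  have y0 : 0 = \sum_j (y j : R[i]) *: (e j : restr (twC0 om) V).
    rewrite -[LHS]sx0 (partition_big m predT) //=; apply: eq_bigr => j _.
    rewrite ffunE scaler_suml; apply: eq_bigr => k /andP[_ /eqP <-] //.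
  have [z [_ zU]] := eP 0.
  have : y (m l) = 0.
    rewrite -(zU y y0) (zU [ffun=> 0]) ?ffunE // big1 // => j _.
    by rewrite ffunE scale0r.
  rewrite ffunE (bigD1 l) ?eqxx //= big1 ?addr0 // => k /andP[/andP[/eqP kl /eqP ml]].
  by rewrite (mI _ _ kl ml) eqxx.
(* Spanning: if x in X represents the coset of c, an invertible element of D_(c-x) carries degree c
   onto degree x, where the b k of that degree span over D_0. *)
pose span t := exists phi : {ffun 'I_n -> D}, t = \sum_k phi k (b k).
have span0 : span 0 by exists [ffun=> 0]; rewrite big1 // => k _; rewrite ffunE.
have spanD t1 t2 : span t1 -> span t2 -> span (t1 + t2).
  move=> [phi1 ->] [phi2 ->]; exists [ffun k => phi1 k + phi2 k]; rewrite -big_split.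
  by apply: eq_bigr => k _; rewrite ffunE.
have spanM (psi : D) t1 : span t1 -> span (psi t1).
  move=> [phi ->]; exists [ffun k => psi * phi k]; rewrite linear_sum.
  by apply: eq_bigr => k _; rewrite ffunE.
have spanb k : span (b k).
  exists [ffun l => if l == k then 1 else 0]; rewrite (bigD1 k) //= ffunE eqxx.
  by rewrite big1 ?addr0 // => l lk; rewrite ffunE (negPf lk).
have spanX c v : c \in X -> span (tau (u c) v).
  move=> cinX; have [x [-> _]] := eP v.
  rewrite -[tau (u c)]/(add_of (tau_additive hT (u c)) : V -> T) raddf_sum.
  elim/big_rec: _ => // j t1 _; apply: spanD => /=.
  have [k kc mk] := mS c j cinX; rewrite -[tau _ _](end_scalarE gcP hT); apply: spanM.
  by rewrite -kc -mk; apply: spanb.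
rewrite -/(span t) [t](gpr_sum gTau); elim/big_rec: _ => // c t1 _; apply: spanD.
have [x xX cx] := X1 c; have /(stabP gcP hT sV)[th hth th0] := cx.
have [th' hth' [e1 e2]] := end_inv gcP hT sV hth th0.
rewrite -[gpr _ _ _]/((1 : D) (gpr gTau c t)) -e1.
apply: (spanM th (th' (gpr gTau c t))); have /asboolP/(_ _ _ (gpr_mem gTau c t)) := hth'.
by rewrite addrA Z2addrr sub0r Z2opp => /(tdegP gcP hT)[v ->]; apply: spanX.
Qed.

End Basis.

Section DegreeMatrix.
Variables (n : nat) (cbar : n.-tuple (Z2 N)) (b : 'I_n -> T).
Hypothesis bd : forall j, b j \in tdeg tau (tnth cbar j).
Hypothesis bP : forall t, exists! phi : {ffun 'I_n -> D}, t = \sum_k phi k (b k).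

(** The homogeneous vector a b_j has a second expansion, in which each coefficient is replaced by
    its component of the required degree; uniqueness of coordinates identifies the two. *)
Lemma dmx_deg c (a : A) : a \in twdeg om c ->
  dmx bP a \in mxdeg (Dd : _ -> {pred D^c}) cbar c.
Proof.
move=> ac; apply/forallP => k; apply/forallP => j; rewrite mxE.
set e := c + tnth cbar j.
have aT : a *: b j \in tdeg tau e by apply: (tdeg_graded gcP hT).2.
have -> : dcoord bP (a *: b j) k = gpr gD (e - tnth cbar k) (dcoord bP (a *: b j) k).
  apply: (@dcoord_uniq _ _ _ _ _ _ _
    (fun k => gpr gD (e - tnth cbar k) (dcoord bP (a *: b j) k))).
  rewrite -[LHS](gpr_id gTau aT) {1}[a *: b j](dcoordE bP) raddf_sum.
  by apply: eq_bigr => l _ /=; rewrite (gpr_end _ _ (bd l)).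
have -> : tnth cbar k + c - tnth cbar j = e - tnth cbar k.
  by rewrite !Z2opp /e [RHS]addrC addrA.
exact: gpr_mem.
Qed.

(** By [dmx_deg], taking matrices commutes with taking components of degree d. With faithfulness
    this gives the converse of [dmx_deg]. *)
Lemma dmx_gpr_eq0 c d (a : A) :
  dmx bP a \in mxdeg (Dd : _ -> {pred D^c}) cbar c -> d != c ->
  dmx bP (gpr (twgr om) d a) = 0.
Proof.
move=> /forallP ha dc; apply/matrixP => k j; rewrite [RHS]mxE.
have /forallP/(_ j) hkj := ha k; pose o := tnth cbar k - tnth cbar j.
have oE e : tnth cbar k + e - tnth cbar j = e + o by rewrite /o addrAC addrC.
rewrite oE in hkj; have := gpr_hom gD (d + o) hkj.
rewrite (inj_eq (addIr o)) (negPf dc) => <-; apply: esym.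
rewrite (@gpr_uniq _ _ _ gD _ (fun e => dmx bP (gpr (twgr om) (e - o) a) k j)) => [|e|].
- by rewrite addrK.
- have /forallP/(_ k)/forallP/(_ j) := dmx_deg (gpr_mem (twgr om) (e - o) a).
  by rewrite oE subrK.
rewrite {1}[a](gpr_sum (twgr om)) raddf_sum summxE [RHS](reindex_inj (addIr o)) /=.
by apply: eq_bigr => e _; rewrite addrK.
Qed.

End DegreeMatrix.
End DivisionBasis.

Theorem mainTheorem5 (R : realType) (gT : finGroupType) (N : nat)
    (p : z2hom gT N) (s : {additive Z2 N -> 'F_2}) (om : cocycle R p s)
    (gc : Z2 N -> gT) (gcP : forall c, p (gc c) = c) :
  (* (1) and (2) *)
  (forall V : lmodType (twalg0 om), simple_module V ->
    (exists (T : lmodType (twalg om)) (tau : twalg om -> V -> T),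
      is_tensor (twincl om) tau) /\
    forall (T : lmodType (twalg om)) (tau : twalg om -> V -> T),
    is_tensor (twincl om) tau ->
    (* (1) *)
    [/\ simple_graded (twdeg om) (tdeg tau),
        is_grading (fun c => gtens tau (gc c)) /\
          (forall c, submod_closed (gtens tau (gc c) : {pred restr (twincl om) T})),
        (forall c, exists2 f : {linear conjmod V (gc c) -> restr (twincl om) T},
            injective f & forall v : V, f v = tau (twb om (gc c)) v),
        (exists2 f : {linear dsum (fun c => conjmod V (gc c)) -> restr (twincl om) T},
            bijective f & forall w : Z2 N -> V, f w = bsum tau gc w)
      & (forall x, has_blocks tau gc (fun t => twC om x *: t) (rhoC gc x)) /\
        (forall g, has_blocks tau gc (fun t => twb om g *: t) (rhoG gc g))] /\
    (* (2) *)
    let Dd := end_deg (tdeg tau) in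
    exists U : {vspace Z2 N},
    [/\ U =i stab gc V,
        exists r (z : r.-tuple (Z2 N)), adapted s U z,
        graded_algebra (fun (x : R) (phi : gend T) => x *: phi) Dd /\
          graded_division Dd,
        forall c, (exists2 phi, phi \in Dd c & phi != 0) <-> c \in U
      & exists iota : {rmorphism R[i] -> gend T},
        [/\ injective iota,
            forall x : R, iota (x%:C)%C = x *: (1 : gend T),
            forall phi, phi \in Dd 0 <-> exists x, phi = iota x,
            forall x, has_blocks tau gc (iota x) (diagC x)
          & forall r (z : r.-tuple (Z2 N)), adapted s U z ->
            forall f : forall i : 'I_r, {linear V -> conjmod V (gc (tnth z i))},
            (forall i, bijective (f i)) ->
            exists theta : 'I_r -> gend T,
            [/\ forall i, has_blocks tau gc (theta i) (theta_block gc (tnth z i) (f i)),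
                forall i, theta i \in Dd (tnth z i) /\
                  (exists phi, theta i * phi = 1 /\ phi * theta i = 1),
                generates (fun phi => phi \in Dd 0 \/ exists i, phi = theta i),
                forall i, exists2 x, x != 0 & theta i ^+ 2 = iota x
              & [/\ forall i, s (tnth z i) = 0 ->
                      exists2 x : R[i], x != 0 & exists2 theta' : gend T,
                        has_blocks tau gc theta'
                          (theta_block gc (tnth z i) (fun v => twC0 om x *: (f i v : V))) &
                        theta' ^+ 2 = 1,
                    forall i, s (tnth z i) = 1 ->
                      forall x, theta i * iota x = iota x^* * theta i,
                    forall i, s (tnth z i) = 1 ->
                      exists2 x : R[i], x != 0 & exists2 theta' : gend T,
                        has_blocks tau gc theta'
                          (theta_block gc (tnth z i) (fun v => twC0 om x *: (f i v : V))) &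
                        theta' ^+ 2 = 1 \/ theta' ^+ 2 = -1
                  & (forall i, s (tnth z i) = 0 -> theta i ^+ 2 = 1) ->
                    (forall i, s (tnth z i) = 1 ->
                      theta i ^+ 2 = 1 \/ theta i ^+ 2 = -1) ->
                    forall i j, i != j ->
                      (theta i * theta j) ^+ 2 = 1 \/
                      (theta i * theta j) ^+ 2 = -1]]]]) /\
  (* (3) *)
  (exists (I : finType) (V : I -> lmodType (twalg0 om)), simple_reps gc V) /\
  (forall (I : finType) (V : I -> lmodType (twalg0 om))
      (T : I -> lmodType (twalg om)) (tau : forall i, twalg om -> V i -> T i),
    simple_reps gc V -> (forall i, is_tensor (twincl om) (tau i)) ->
    [/\ forall i, simple_graded (twdeg om) (tdeg (tau i)),
        forall (M : lmodType (twalg om)) (Md : Z2 N -> {pred M}),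
          simple_graded (twdeg om) Md ->
          exists i c, giso Md (shift (tdeg (tau i)) c),
        forall i j c, giso (tdeg (tau i)) (shift (tdeg (tau j)) c) -> i = j,
        exists d0 : I -> nat, forall i, has_dim (restr (twC0 om) (V i)) (d0 i)
      & forall d0 : I -> nat,
          (forall i, has_dim (restr (twC0 om) (V i)) (d0 i)) ->
        let E i := stab gc (V i) in
        let d' i := (#|cosets (E i)| * d0 i)%N in
        forall (X : I -> {set Z2 N}) (cbar : forall i, (d' i).-tuple (Z2 N)),
          (forall i, is_transversal (X i) (cosets (E i)) [set: Z2 N]) ->
          (forall i c, count_mem c (cbar i) = ((c \in X i) * d0 i)%N) ->
        (forall i, exists d dD : nat,
          [/\ has_dim (restr (GRing.in_alg (twalg om)) (T i)) d,
              has_dim (gend (T i)) dD, (0 < dD)%N & d = (d' i * dD)%N]) /\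
        exists Phi : forall i, {rmorphism twalg om -> 'M[(gend (T i))^c]_(d' i)},
        [/\ forall i (x : R) a,
              Phi i (x *: a) = map_mx (fun phi : gend (T i) => x *: phi) (Phi i a),
            forall B : (forall i, 'M[(gend (T i))^c]_(d' i)),
              exists! a, forall i, Phi i a = B i,
            forall c a, a \in twdeg om c <->
              forall i, Phi i a \in mxdeg (end_deg (tdeg (tau i)) : _ -> {pred (gend (T i))^c}) (cbar i) c
          & forall i, exists b : 'I_(d' i) -> T i,
            [/\ forall j, b j \in tdeg (tau i) (tnth (cbar i) j),
                forall t, exists! phi : {ffun 'I_(d' i) -> gend (T i)},
                  t = \sum_k phi k (b k)
              & forall a j, a *: b j =
                  \sum_k ((Phi i a k j : gend (T i)) (b k))]]]).
Proof.
split; last split; last first.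
- move=> I V T tau repsV hT; have [sV _ _] := repsV.
  split.
  + by move=> i; apply: (tensor_simple gcP (hT i)).
  + exact: (simple_graded_classify gcP repsV hT).
  + exact: (giso_eq gcP repsV hT).
  + exists (fun i => sval (cid (simple_has_dim (sV i)))) => i.
    by case: cid.
  move=> d0 hd0 E d' X cbar trX cbarP.
  have hb i := division_basis gcP (hT i) (sV i) (hd0 i) (trX i) (cbarP i).
  pose b i := sval (cid (hb i)).
  have bd i j : b i j \in tdeg (tau i) (tnth (cbar i) j).
    by rewrite /b; case: cid => ? /= [].
  have bP i : forall t, exists! phi : {ffun 'I_(d' i) -> gend (T i)},
      t = \sum_k phi k (b i k).
    by rewrite /b; case: cid => ? /= [].
  split=> [i|].
    have [m m0 hm] := gend_has_dim gcP (hT i) (sV i).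
    by exists (d' i * m)%N, m; split=> //; apply: has_dim_gend_basis (bP i) _ hm.
  have faith (a : twalg om) : (forall i, dmx (bP i) a = 0) -> a = 0.
    move=> ha; apply: (simple_graded_faithful gcP repsV hT) => i t.
    rewrite (dcoordE (bP i) t) scaler_sumr big1 // => k _.
    have e (phi : gend (T i)) : phi (a *: b i k) = a *: phi (b i k) by rewrite linearZ.
    rewrite -e (dmxE (bP i)) ha; rewrite big1 ?linear0 // => j _.
    by rewrite mxE.
  exists (fun i => dmx (bP i)); split.
  + by move=> i x a; apply: dmxZ.
  + move=> B.
    (* The operator with matrix [B i] in the basis [b i] commutes with all of [gend (T i)], so
       density provides the preimage a. *)
    have [a aE] : exists a : twalg om, forall i t, a *: t =
        \sum_j dcoord (bP i) t j (\sum_k (B i k j : gend (T i)) (b i k)).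
      apply: (density gcP repsV hT) => [i t t'|i phi t].
        rewrite -big_split; apply: eq_bigr => j _.
        by rewrite dcoordD.
      rewrite linear_sum; apply: eq_bigr => j _.
      by rewrite dcoordM.
    exists a; split=> [i|a' a'E].
      apply: dmx_uniq => j; rewrite aE.
      exact: (dcoord_basis_sum (bP i) (fun j => \sum_k (B i k j : gend (T i)) (b i k))).
    apply/eqP; rewrite -subr_eq0; apply/eqP/faith => i.
    rewrite raddfB /= a'E; apply/eqP; rewrite subr_eq0; apply/eqP.
    apply: dmx_uniq => j; rewrite aE.
    exact: (dcoord_basis_sum (bP i) (fun j => \sum_k (B i k j : gend (T i)) (b i k))).
  + move=> c a; split=> [ac i|ha]; first exact: (dmx_deg gcP (hT i) (bd i) _ ac).
    apply/(gpr_memP (twgr om)); rewrite {2}[a](gpr_sum (twgr om)) (bigD1 c) //=.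
    rewrite big1 ?addr0 // => d dc; apply: faith => i.
    exact: (dmx_gpr_eq0 gcP (hT i) (bd i) (ha i) dc).
  + move=> i; exists (b i); split; [exact: bd | exact: bP |].
    by move=> a j; apply: dmxE.
- exact: simple_reps_exists.
move=> V sV; split; first exact: tensor_exists.
move=> T tau hT; split.
  split.
  - exact: (tensor_simple gcP hT).
  - split; first exact: (gtens_grading gcP hT).
    by move=> c; apply: (gtens_submod gc hT).
  - by move=> c; have [F FI FE] := conj_linear_inj gcP hT (gc c); exists F.
  - exact: (dsum_conj_iso gcP hT).
  - by split=> ?; [apply: (rhoC_blocks gc hT) | apply: (rhoG_blocks gcP hT)].
have [U UE] := submod_vspace (stab_submod gcP hT sV).
exists U; split=> //.
- exact: adapted_exists.
- by split; [apply: (end_graded gcP hT) | apply: (end_division gcP hT sV)].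
- by move=> c; rewrite UE; apply: (stabP gcP hT sV).
exists (end_scalar gcP hT); split.
- exact: end_scalar_inj.
- exact: end_scalarR.
- exact: (end0P gcP hT sV).
- exact: end_scalar_blocks.
move=> r z [zB zs] f bf.
have [theta thP] : exists theta : 'I_r -> gend T, forall i,
    [/\ forall a v, theta i (tau a v) = tau (a * twb om (gc (tnth z i))) (f i v),
        has_blocks tau gc (theta i) (theta_block gc (tnth z i) (f i)),
        theta i \in end_deg (tdeg tau) (tnth z i) & theta i != 0].
  have th i := theta_exists gcP hT sV (bf i).
  by exists (fun i => sval (cid (th i))) => i; case: cid.
exists theta.
split.
- by move=> i; have [] := thP i.
- move=> i; have [_ _ h1 h2] := thP i; split=> //.
  exact: (end_division gcP hT sV h1 h2).
- apply: (end_generated gcP hT sV UE zB) => i.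
  by have [] := thP i.
- by move=> i; have [_ _ h1 h2] := thP i; apply: (end_sqr gcP hT sV h1 h2).
split.
- move=> i si; have [h0 _ h1 h2] := thP i.
  have [x x0 xE] := end_linear_normalize gcP hT sV si h1 h2.
  exists x => //; exists (end_scalar gcP hT x * theta i) => //.
  exact: (theta_scale_blocks gcP hT _ h0).
- by move=> i si x; have [_ _ h1 _] := thP i; apply: (end_antilinear gcP hT x si h1).
- move=> i si; have [h0 _ h1 h2] := thP i.
  have [x x0 xE] := end_antilinear_normalize gcP hT sV si h1 h2.
  exists x => //; exists (end_scalar gcP hT x * theta i) => //.
  exact: (theta_scale_blocks gcP hT _ h0).
move=> sq0 sq1 i j ij; have [_ _ hi _] := thP i; have [_ _ hj _] := thP j.
have sqr k : theta k ^+ 2 = 1 \/ theta k ^+ 2 = -1.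
  by case: (F2_cases (s (tnth z k))) => [/sq0|/sq1]; [left |].
case: (F2_cases (s (tnth z i))) => si.
  exact: (end_sign gcP hT sV si hi hj (sq0 i si) (sqr j)).1.
(* An antilinear theta occurs only at the first basis vector, so theta j is linear and [end_sign]
   applies with the factors exchanged. *)
have sj : s (tnth z j) = 0.
  have zU k : tnth z k \in U by rewrite (basis_mem zB) ?mem_tnth.
  have zs' : exists2 c, c \in U & s c != 0 by exists (tnth z i); rewrite ?si ?oner_eq0.
  move: si; rewrite !(zs zs'); have [i0 _|_ /eqP] := eqVneq (i : nat) 0%N; last first.
    by rewrite eq_sym oner_eq0.
  by case: eqP => // j0; case/eqP: ij; apply: val_inj; rewrite /= i0 j0.
exact: (end_sign gcP hT sV sj hj hi (sq0 j sj) (sqr i)).2.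
Qed.
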